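(* Let $n\ge 1$, $\pi=\mathbb Z^n$, and let $\mathcal C$ be a finitely generated based free $\mathbb Z[\mathbb Z^n]$-complex which is $L^2$-acyclic. Then $$\lim_{\langle\Gamma\rangle\to\infty,\ [\mathbb Z^n:\Gamma]<\infty}\frac{\ln\left(\tau^{H}(\mathcal C_\Gamma)\right)-\ln\left(\tau^{RS}(\mathcal C_\Gamma)\right)}{[\mathbb Z^n:\Gamma]}=0.$$
   Context: A finitely generated based free $\mathbb Z[\pi]$-complex $\mathcal C$ is a chain complex $0\to C_m\xrightarrow{\partial_m}C_{m-1}\to\cdots\to C_1\xrightarrow{\partial_1}C_0\to 0$ of finitely generated free $\mathbb Z[\pi]$-modules, each equipped with a preferred base. For $\pi=\mathbb Z^n$, $\mathcal C$ is called $L^2$-acyclic if $H_k(\mathcal C\otimes_{\mathbb Z[\mathbb Z^n]}F)=0$ for every $k$, where $F$ is the fraction field of the domain $\mathbb Z[\mathbb Z^n]$ (this is equivalent to the vanishing of all $L^2$-homology groups $H^{(2)}_k(\mathcal C)$). For a finite-index subgroup $\Gamma\le\pi=\mathbb Z^n$, $\mathcal C_\Gamma:=\mathbb Z[\pi/\Gamma]\otimes_{\mathbb Z[\pi]}\mathcal C$. It is a finitely generated based free $\mathbb Z$-complex: if $c_1,\dots,c_b$ is the preferred base of $C_k$, the preferred $\mathbb Z$-base of $\mathbb Z[\pi/\Gamma]\otimes C_k$ consists of the elements $a\otimes c_i$ with $a\in\pi/\Gamma$, $1\le i\le b$. Fix a finite generating set $S$ of $\mathbb Z^n$ with word length $l_S$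 and put $\langle\Gamma\rangle:=\min\{l_S(x)\mid x\in\Gamma\setminus\{e\}\}$, where $e$ is the identity of the group. The limit statement $\lim_{\langle\Gamma\rangle\to\infty,\,[\mathbb Z^n:\Gamma]<\infty}f(\Gamma)=0$ means: for every $\varepsilon>0$ there is $N$ such that $|f(\Gamma)|<\varepsilon$ for every finite-index subgroup $\Gamma\le\mathbb Z^n$ with $\langle\Gamma\rangle\ge N$. (It does not depend on $S$.) Write $\prod^*_k a_k=\prod_k a_k^{(-1)^k}$. For a finitely generated based free $\mathbb Z$-complex $\mathcal E=(E_k,d_k)$: - The homology torsion is $\tau^H(\mathcal E)=\left(\prod^*_k|\mathrm{tor}_{\mathbb Z}(H_k(\mathcal E))|\right)^{-1}$, where $\mathrm{tor}_{\mathbb Z}(M)$ is the torsion subgroup of the finitely generated abelian group $M$. - The Ray-Singer torsion is $\tau^{RS}(\mathcal E)=\prod^*_k{\det}'(d_k)$. Here each $E_k\otimes_{\mathbb Z}\mathbb C$ is given the Hermitian product for which the preferred base is orthonormal, and, for a linear map $f$ of finite-dimensional Hermitian spaces, ${\det}'(f)$ is the product (with multiplicity) of all nonzero singular values of $f$, with ${\det}'(0)=1$. *)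

(* Defs.v *)
From HB Require Import structures.
From mathcomp Require Import all_boot all_order all_algebra.
From mathcomp Require Import finmap ring_quotient sesquilinear spectral complex monalg.
From mathcomp Require Import boolp classical_sets functions cardinality.
From mathcomp Require Import reals exp.

Set Implicit Arguments.
Unset Strict Implicit.
Unset Printing Implicit Defensive.

Import Order.TTheory GRing.Theory Num.Theory.

Local Open Scope classical_set_scope.
Local Open Scope fset_scope.
Local Open Scope ring_scope.
Local Open Scope sesquilinear_scope.

(* The library's product on {malg int[G]} requires a monoid without
   invertible elements, so only its additive structure is used here. *)
Definition group_ring (G : zmodType) := {malg int[G]}.

Section GroupRing.
Variable G : zmodType.

HB.instance Definition _ := GRing.Zmodule.on (group_ring G).

Implicit Types (p q r : group_ring G) (x y : G) (c : int).

Definition gr_one : group_ring G := << 1 *g 0 >>.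

Definition gr_mul p q : group_ring G :=
  \sum_(x <- msupp p) \sum_(y <- msupp q) << p@_x * q@_y *g x + y >>.

Lemma gr_mulEw (d1 d2 : {fset G}) p q :
  msupp p `<=` d1 -> msupp q `<=` d2 ->
  gr_mul p q =
    \sum_(x <- d1) \sum_(y <- d2) << p@_x * q@_y *g x + y >>.
Proof.
move=> le1 le2; rewrite /gr_mul.
rewrite (big_fset_incl _ le1)/=; last first.
  by move=> x _ /mcoeff_outdom ->; rewrite big1// => y _; rewrite mul0r monalgU0.
apply: eq_bigr => x _; rewrite (big_fset_incl _ le2)//=.
by move=> y _ /mcoeff_outdom ->; rewrite mulr0 monalgU0.
Qed.

Lemma gr_mulC : commutative gr_mul.
Proof.
move=> p q; rewrite /gr_mul exchange_big/=; apply: eq_bigr => y _.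
by apply: eq_bigr => x _; rewrite mulrC addrC.
Qed.

Lemma gr_mulUU c1 c2 x1 x2 :
  gr_mul << c1 *g x1 >> << c2 *g x2 >> = << c1 * c2 *g x1 + x2 >>.
Proof.
by rewrite (gr_mulEw msuppU_le msuppU_le) !big_seq_fset1 !mcoeffUU.
Qed.

Lemma gr_mulDl : left_distributive gr_mul +%R.
Proof.
move=> p q r; rewrite (gr_mulEw (msuppD_le p q) (fsubset_refl _)).
rewrite (gr_mulEw (fsubsetUl (msupp p) (msupp q)) (fsubset_refl _)).
rewrite (gr_mulEw (fsubsetUr (msupp p) (msupp q)) (fsubset_refl _)).
rewrite -big_split /=; apply/eq_bigr=> x _.
rewrite -big_split /=; apply/eq_bigr=> y _.
by rewrite mcoeffD mulrDl monalgUD.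
Qed.

Lemma gr_mulDr : right_distributive gr_mul +%R.
Proof. by move=> p q r; rewrite gr_mulC gr_mulDl !(gr_mulC p). Qed.

Lemma gr_mul0 p : gr_mul 0 p = 0.
Proof. by rewrite /gr_mul msupp0 big_seq_fset0. Qed.

Lemma gr_mulr0 p : gr_mul p 0 = 0.
Proof. by rewrite gr_mulC gr_mul0. Qed.

Lemma gr_mul_suml (I : Type) (s : seq I) (F : I -> group_ring G) p :
  gr_mul (\sum_(i <- s) F i) p = \sum_(i <- s) gr_mul (F i) p.
Proof. exact: (big_morph (gr_mul^~ p) (fun _ _ => gr_mulDl _ _ _) (gr_mul0 p)). Qed.

Lemma gr_mul_sumr (I : Type) (s : seq I) (F : I -> group_ring G) p :
  gr_mul p (\sum_(i <- s) F i) = \sum_(i <- s) gr_mul p (F i).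
Proof. exact: (big_morph (gr_mul p) (fun _ _ => gr_mulDr _ _ _) (gr_mulr0 p)). Qed.

Lemma gr_ind (P : group_ring G -> Prop) :
  P 0 -> (forall p q, P p -> P q -> P (p + q)) ->
  (forall c x, P << c *g x >>) -> forall p, P p.
Proof.
move=> P0 PD PU p; rewrite [p]monalgE.
by apply: (big_ind P) => // x _; apply: PU.
Qed.

Lemma gr_mulA : associative gr_mul.
Proof.
move=> p q r; elim/gr_ind: p => [|p p' Hp Hp'|c x].
- by rewrite !gr_mul0.
- by rewrite !gr_mulDl Hp Hp'.
elim/gr_ind: q => [|q q' Hp Hp'|c' x'].
- by rewrite !(gr_mul0,gr_mulr0).
- by rewrite !(gr_mulDl,gr_mulDr) Hp Hp'.
elim/gr_ind: r => [|r r' Hp Hp'|c'' x''].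
- by rewrite !gr_mulr0.
- by rewrite !gr_mulDr Hp Hp'.
by rewrite !gr_mulUU mulrA addrA.
Qed.

Lemma gr_mul1 : left_id gr_one gr_mul.
Proof.
move=> p; elim/gr_ind: p => [|p p' Hp Hp'|c x].
- by rewrite gr_mulr0.
- by rewrite gr_mulDr Hp Hp'.
by rewrite gr_mulUU mul1r add0r.
Qed.

Lemma gr_one_neq0 : gr_one != 0.
Proof. by rewrite monalgU_eq0. Qed.

HB.instance Definition _ := GRing.Zmodule_isComNzRing.Build (group_ring G)
  gr_mulA gr_mulC gr_mul1 gr_mulDl gr_one_neq0.

Lemma gr_mulE p q : p * q = gr_mul p q. Proof. by []. Qed.

Lemma mcoeff_grM p q k :
  (p * q)@_k = \sum_(x <- msupp p) p@_x * q@_(k - x).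
Proof.
elim/gr_ind: q => [|q q' Hq Hq'|c y].
- by rewrite mulr0 mcoeff0 big1// => x _; rewrite mcoeff0 mulr0.
- rewrite mulrDr mcoeffD Hq Hq' -big_split/=; apply: eq_bigr => x _.
  by rewrite mcoeffD mulrDr.
rewrite gr_mulE (gr_mulEw (fsubset_refl _) msuppU_le) raddf_sum/=.
apply: eq_bigr => x _; rewrite big_seq_fset1 mcoeffUU !mcoeffU mulrnAr.
by rewrite -(inj_eq (addrI (- x))) addKr [- x + k]addrC.
Qed.

Definition gr_unit : pred (group_ring G) := fun p => `[< exists q, q * p = 1 >].

Definition gr_inv p : group_ring G :=
  if pselect (exists q, q * p = 1) is left h then projT1 (cid h) else p.

Lemma gr_mulVx : {in gr_unit, left_inverse 1 gr_inv *%R}.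
Proof.
move=> p /asboolP h; rewrite /gr_inv; case: pselect => // h'.
exact: (projT2 (cid h')).
Qed.

Lemma gr_unitPl p q : q * p = 1 -> p \in gr_unit.
Proof. by move=> h; apply/asboolP; exists q. Qed.

Lemma gr_inv_out : {in [predC gr_unit], gr_inv =1 id}.
Proof.
move=> p /asboolPn h; rewrite /gr_inv; case: pselect => // h'.
Qed.

HB.instance Definition _ :=
  GRing.ComNzRing_hasMulInverse.Build (group_ring G)
    gr_mulVx gr_unitPl gr_inv_out.

End GroupRing.

Section GroupRingMap.
Variables (G H : zmodType) (f : {additive G -> H}).

Definition gr_map (p : group_ring G) : group_ring H :=
  \sum_(x <- msupp p) << p@_x *g f x >>.

Lemma gr_mapEw (d : {fset G}) (p : group_ring G) : msupp p `<=` d ->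
  gr_map p = \sum_(x <- d) << p@_x *g f x >>.
Proof.
move=> le; rewrite /gr_map (big_fset_incl _ le)//=.
by move=> x _ /mcoeff_outdom ->; rewrite monalgU0.
Qed.

Lemma gr_mapU c x : gr_map << c *g x >> = << c *g f x >>.
Proof. by rewrite (gr_mapEw msuppU_le) big_seq_fset1 mcoeffUU. Qed.

Lemma gr_map_zmod : zmod_morphism gr_map.
Proof.
move=> p q; rewrite (gr_mapEw (msuppB_le p q)).
rewrite (gr_mapEw (fsubsetUl (msupp p) (msupp q))).
rewrite (gr_mapEw (fsubsetUr (msupp p) (msupp q))) -sumrB.
by apply: eq_bigr => x _; rewrite mcoeffB monalgUB.
Qed.

HB.instance Definition _ :=
  GRing.isZmodMorphism.Build (group_ring G) (group_ring H) gr_map gr_map_zmod.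

Lemma gr_map_monoid : monoid_morphism gr_map.
Proof.
split; first by rewrite gr_mapU raddf0.
move=> p q; elim/gr_ind: p => [|p p' Hp Hp'|c x].
- by rewrite !(mul0r, raddf0).
- by rewrite !(mulrDl, raddfD) /= Hp Hp'.
elim/gr_ind: q => [|q q' Hp Hp'|c' x'].
- by rewrite !(mulr0, raddf0).
- by rewrite !(mulrDr, raddfD) /= Hp Hp'.
by rewrite !gr_mulE gr_mulUU !gr_mapU gr_mulUU raddfD.
Qed.

HB.instance Definition _ :=
  GRing.isMonoidMorphism.Build (group_ring G) (group_ring H) gr_map gr_map_monoid.

End GroupRingMap.

(* Z[Z^n], with the group Z^n written additively as 'rV[int]_n; the element
   x of Z^n is << x >>. The alias carries the integral domain structure. *)
Definition Zpi (n : nat) := group_ring 'rV[int]_n.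

HB.instance Definition _ n := GRing.ComUnitRing.on (Zpi n).

Section Integral.
Variable n : nat.

Let lex (u : 'rV[int]_n) : n.-tuplelexi int := [tuple u 0 i | i < n].

Let lex_inj : injective lex.
Proof.
move=> u v uv; apply/rowP => i.
by have := congr1 (fun t => tnth t i) uv; rewrite !tnth_mktuple.
Qed.

Let lex_ltD u v w : (lex u < lex v)%O -> (lex (u + w) < lex (v + w))%O.
Proof.
move=> /ltxi_tuplePlt[k eqk ltk]; apply/ltxi_tuplePlt; exists k.
  by move=> i ik; have := eqk i ik; rewrite !tnth_mktuple !mxE => ->.
by move: ltk; rewrite !tnth_mktuple !mxE ltrD2r.
Qed.

Let lex_leD u v u' v' : (lex u <= lex u')%O -> (lex v <= lex v')%O ->
  u + v = u' + v' -> u = u'.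
Proof.
rewrite le_eqVlt => /orP[/eqP/lex_inj//|uu'] vv' e; exfalso.
have : (lex (u + v) < lex (u' + v'))%O.
  apply: lt_le_trans (lex_ltD v uu') _.
  move: vv'; rewrite le_eqVlt => /orP[/eqP/lex_inj->//|vv'].
  by rewrite ltW// ![u' + _]addrC lex_ltD.
by rewrite e ltxx.
Qed.

Let lex_max (s : {fset 'rV[int]_n}) : s != fset0 ->
  exists2 m, m \in s & forall x, x \in s -> (lex x <= lex m)%O.
Proof.
case/fset0Pn => x0 x0s.
have [i _ /= H] := arg_maxP (fun x : s => lex (val x)) (erefl true : xpredT [` x0s]).
exists (val i) => [|x xs]; first exact: valP.
exact: (H [` xs] isT).
Qed.

Lemma Zpi_integral : GRing.integral_domain_axiom (Zpi n).
Proof.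
move=> p q pq0; rewrite -implyNb; apply/implyP => p0.
apply: contra_eqT pq0 => q0.
have supp0 (r : Zpi n) : r != 0 -> msupp r != fset0.
  by apply: contraNneq => r0; apply/eqP/malgP => k; rewrite mcoeff_outdom ?r0// mcoeff0.
have [x xp xmax] := lex_max (supp0 _ p0).
have [y yq ymax] := lex_max (supp0 _ q0).
apply/eqP => /(congr1 (mcoeff (x + y))) /eqP; rewrite mcoeff0.
rewrite [_@_ _]mcoeff_grM (big_fsetD1 x)//= big1_fset ?addr0; last first.
  move=> z /fsetD1P[zx zp] _.
  have [|nz] := boolP (x + y - z \in msupp q); last first.
    by rewrite [q@_(_)]mcoeff_outdom ?mulr0.
  move=> /ymax ley; case/eqP: zx; apply: (lex_leD (xmax _ zp) ley).
  by rewrite addrC subrK.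
by rewrite addrAC subrr add0r mulf_eq0 !mcoeff_eq0 xp yq.
Qed.

HB.instance Definition _ :=
  GRing.ComUnitRing_isIntegral.Build (Zpi n) Zpi_integral.

End Integral.

(* The k-th chain module is R^(crank k), as row vectors, with its standard
   base; bd k is the matrix of the differential from degree k.+1 to degree k,
   acting on the right. *)
Record based_complex (R : nzRingType) := BasedComplex {
  clength : nat;
  crank : nat -> nat;
  crank_eq0 : forall k, (clength < k)%N -> crank k = 0%N;
  bd : forall k, 'M[R]_(crank k.+1, crank k);
  bdK : forall k, bd k.+1 *m bd k = 0 }.

Section BaseChange.
Variables (R S : nzRingType) (f : {rmorphism R -> S}) (C : based_complex R).

Fact base_change_bdK k : map_mx f (bd C k.+1) *m map_mx f (bd C k) = 0.
Proof. by rewrite -map_mxM bdK map_mx0. Qed.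

Definition base_change : based_complex S :=
  BasedComplex (@crank_eq0 _ C) base_change_bdK.

End BaseChange.

Section Homology.
Variables (R : nzRingType) (C : based_complex R) (k : nat).

Definition target_crank : nat := if k is k'.+1 then crank C k' else 0%N.

Definition differential : 'M[R]_(crank C k, target_crank) :=
  match k return 'M[R]_(crank C k, if k is k'.+1 then crank C k' else 0%N) with
  | 0 => 0
  | k'.+1 => bd C k'
  end.

Definition cycle_pred : {pred 'rV[R]_(crank C k)} :=
  fun v => v *m differential == 0.

Fact cycle_zmod_closed : zmod_closed cycle_pred.
Proof.
split=> [|u v]; rewrite !unfold_in ?mul0mx//.
by move=> /eqP u0 /eqP v0; rewrite mulmxBl u0 v0 subr0.
Qed.

HB.instance Definition _ :=
  GRing.isZmodClosed.Build 'rV[R]_(crank C k) cycle_pred cycle_zmod_closed.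

Record cycle_sub := Cycle {
  cycle_val :> 'rV[R]_(crank C k);
  _ : cycle_val \in cycle_pred }.

HB.instance Definition _ := [isSub for cycle_val].
HB.instance Definition _ := [Choice of cycle_sub by <:].
HB.instance Definition _ := [SubChoice_isSubZmodule of cycle_sub by <:].

Definition is_boundary : {pred cycle_sub} :=
  fun z => `[< exists c : 'rV[R]_(crank C k.+1), val z = c *m bd C k >].

Fact boundary_zmod_closed : zmod_closed is_boundary.
Proof.
split; first by apply/asboolP; exists 0; rewrite mul0mx raddf0.
move=> u v /asboolP[c cE] /asboolP[d dE]; apply/asboolP; exists (c - d).
by rewrite mulmxBl -cE -dE raddfB.
Qed.

HB.instance Definition _ :=
  GRing.isZmodClosed.Build cycle_sub is_boundary boundary_zmod_closed.

Definition homology : zmodType := Quotient.quot is_boundary.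

End Homology.

Definition L2_acyclic n (C : based_complex (Zpi n)) :=
  forall k (h : homology (base_change (@FracField.tofrac (Zpi n)) C) k), h = 0.

(* fset_set returns the empty set on infinite sets: this is the number of
   elements when G is finite, and 0 otherwise. *)
Definition group_order (G : choiceType) : nat := #|` fset_set [set: G]|.

Section RestrictScalars.
Variables (G : zmodType) (C : based_complex (group_ring G)).

Definition nth_elt (a : 'I_(group_order G)) : G := nth 0 (fset_set [set: G]) a.

(* Matrix of multiplication by p on Z[G] in the base G, for G finite. *)
Definition regmx (p : group_ring G) : 'M[int]_(group_order G) :=
  \matrix_(a, b) p@_(nth_elt b - nth_elt a).

Lemma regmx0 : regmx 0 = 0.
Proof. by apply/matrixP => a b; rewrite !mxE mcoeff0. Qed.

Lemma regmxD p q : regmx (p + q) = regmx p + regmx q.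
Proof. by apply/matrixP => a b; rewrite !mxE mcoeffD. Qed.

Lemma regmxM p q : regmx (p * q) = regmx p *m regmx q.
Proof.
apply/matrixP => a b; rewrite !mxE mcoeff_grM.
have finG : finite_set [set: G].
  apply: contrapT => infG; case: (a) => i; rewrite /group_order /fset_set.
  by case: pselect => // ? ; rewrite cardfs0.
have inG x : x \in fset_set [set: G] by rewrite in_fset_set// inE.
transitivity (\sum_(x <- fset_set [set: G]) p@_x * q@_(nth_elt b - nth_elt a - x)).
  apply: big_fset_incl => [|x _ /mcoeff_outdom ->]; last by rewrite mul0r.
  by apply/fsubsetP => x _.
have perm_shift : perm_eq [seq x - nth_elt a | x <- fset_set [set: G]]
    (fset_set [set: G]).
  apply: uniq_perm => [||x]; rewrite ?map_inj_uniq ?fset_uniq//.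
    exact: addIr.
  by rewrite inG; apply/mapP; exists (x + nth_elt a); rewrite ?inG ?addrK.
rewrite -(perm_big _ perm_shift)/= big_map (big_nth 0) big_mkord.
apply: eq_bigr => c _; rewrite !mxE; congr (_ * mcoeff _ _).
by rewrite opprB addrA subrK.
Qed.

Fact restrict_scalars_rk0 k : (clength C < k)%N ->
  (\sum_(i < crank C k) group_order G)%N = 0%N.
Proof. by move=> /crank_eq0; rewrite sum_nat_const card_ord => ->. Qed.

Fact restrict_scalars_bdK k :
  (\mxblock_(i < crank C k.+2, j < crank C k.+1) regmx (bd C k.+1 i j)) *m
  (\mxblock_(i < crank C k.+1, j < crank C k) regmx (bd C k i j)) = 0.
Proof.
rewrite mul_mxblock -[RHS]mxblock0; apply: eq_mxblock => i j.
under eq_bigr do rewrite -regmxM.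
rewrite -(big_morph _ regmxD regmx0).
have /matrixP/(_ i j) := bdK C k; rewrite !mxE => ->; exact: regmx0.
Qed.

(* C seen as a complex over Z: block i of the base consists of the elements
   a c_i, for a ranging over G. *)
Definition restrict_scalars : based_complex int :=
  BasedComplex restrict_scalars_rk0 restrict_scalars_bdK.

End RestrictScalars.

Section FiniteIndex.
Variables (n : nat) (Gamma : zmodClosed 'rV[int]_n).

Definition finite_index : Prop := finite_set [set: Quotient.quot Gamma].

Definition subgroup_index : nat := group_order (Quotient.quot Gamma).

Definition quot_proj : {additive 'rV[int]_n -> Quotient.quot Gamma} :=
  \pi_(Quotient.quot Gamma)%qT.

Definition quot_complex (C : based_complex (Zpi n)) : based_complex int :=
  restrict_scalars (base_change (gr_map quot_proj) C).

End FiniteIndex.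

Section WordLength.
Variables (n : nat) (S : seq 'rV[int]_n).

(* The least element of A, or 0 if A is empty (never the case below for a
   generating S and a nontrivial Gamma). *)
Definition min_nat (A : set nat) : nat :=
  xget 0%N [set k | A k /\ forall j, A j -> (k <= j)%N].

Definition is_word (w : seq 'rV[int]_n) (x : 'rV[int]_n) : Prop :=
  (forall s, s \in w -> (s \in S) || (- s \in S)) /\ \sum_(s <- w) s = x.

Definition generates : Prop := forall x, exists w, is_word w x.

Definition word_length (x : 'rV[int]_n) : nat :=
  min_nat [set k | exists2 w, is_word w x & size w = k].

Definition systole (Gamma : zmodClosed 'rV[int]_n) : nat :=
  min_nat [set k | exists x, [/\ x \in Gamma, x != 0 & word_length x = k]].

End WordLength.

Definition torsion_subgroup (M : zmodType) : set M :=
  [set x | exists2 m, (0 < m)%N & x *+ m = 0].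
Arguments torsion_subgroup M : clear implicits.

Section Torsion.
Variables (R : realType) (E : based_complex int).

Definition alt_prod (a : nat -> R) : R :=
  \prod_(k < (clength E).+1) a k ^ ((-1) ^+ k : int).

Definition homology_torsion : R :=
  (alt_prod (fun k => #|` fset_set (torsion_subgroup (homology E k))|%:R))^-1.

(* The matrix A acts on row vectors on the right, so that A *m A ^t* is the
   matrix of f^* f. *)
Definition singular_value m p (A : 'M[R[i]]_(m, p)) (j : 'I_m) : R :=
  Num.sqrt (complex.Re (spectral_diag (A *m A ^t*) 0 j)).

Definition det' m p (A : 'M[R[i]]_(m, p)) : R :=
  \prod_(j < m | singular_value A j != 0) singular_value A j.

Definition ray_singer_torsion : R :=
  alt_prod (fun k => det' (map_mx intr (differential E k))).

End Torsion.

(* Main.v *)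
(* For a based free complex E over Z, tau^RS / tau^H is an alternating product of
   covolumes vol(Z_k) / vol(sat B_k), where Z_k is the lattice of cycles and
   sat B_k the saturation of the lattice of boundaries; so it suffices to bound
   each of these quotients, and its inverse, by exp(o([Z^n : Gamma])). The two
   bounds are the same statement for C and for the transposed complex.

   Acyclicity over the fraction field gives a nonzero p in Z[Z^n] annihilating
   the homology of every C_Gamma, which is thus supported on the characters chi
   of Z^n / Gamma with chi(p) = 0. By Mann's theorem on vanishing sums of roots
   of unity, each such chi satisfies chi(x) = 1 for some x in a finite set of
   nonzero elements that depends on p only. Hence, rationally, Z_k is spanned by
   B_k and by the indicators of the orbits of the translations by these x.
   Adding these vectors to a basis of sat B_k multiplies its covolume by at most
   the product of their lengths, and the boundary operator, having bounded norm
   and mapping integral vectors to integral vectors, cannot make the covolume of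
   Z_k much larger than that. The orbits have size at least a constant times
   <Gamma>, and sum_O ln |O| is o(sum_O |O|) when all the orbits O are large. *)
Require Import Defs.
From mathcomp Require Import all_boot all_order all_algebra all_fingroup all_field cyclic.
From mathcomp Require Import finmap complex monalg generic_quotient.
From mathcomp Require Import boolp classical_sets cardinality.
From mathcomp Require Import reals exp ring lra zify.

Set Implicit Arguments.
Unset Strict Implicit.
Unset Printing Implicit Defensive.

Import Order.TTheory GRing.Theory Num.Theory.

Local Open Scope ring_scope.

(** * Smith decompositions and covolumes *)

(** Equivalently, [row_mx L K'] is invertible with inverse [col_mx L' K]. Spelling out the blocks
    avoids casts along [m = r + s]; the rows of [K] form a basis of the left kernel of [L]. *)
Record unimodular_split (R : comNzRingType) m r s (L : 'M[R]_(m, r)) (L' : 'M[R]_(r, m))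
    (K : 'M[R]_(s, m)) (K' : 'M[R]_(m, s)) : Prop := UnimodularSplit {
  us_dim : m = (r + s)%N;
  us_L'L : L' *m L = 1%:M;
  us_KL : K *m L = 0;
  us_KK' : K *m K' = 1%:M;
  us_L'K' : L' *m K' = 0;
  us_sum : L *m L' + K' *m K = 1%:M }.

Lemma unimodular_split_unit (R : comUnitRingType) r s (U : 'M[R]_(r + s)) : U \in unitmx ->
  unimodular_split (lsubmx U) (usubmx (invmx U)) (dsubmx (invmx U)) (rsubmx U).
Proof.
move=> uU.
have := mulVmx uU; rewrite -[X in X *m _]vsubmxK -[X in _ *m X]hsubmxK mul_col_row scalar_mx_block.
move=> /eq_block_mx[e1 e2 e3 e4]; split=> //.
have := mulmxV uU; rewrite -[X in X *m _]hsubmxK -[X in _ *m X]vsubmxK mul_row_col.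
by [].
Qed.

(* Jacobi's complementary minor identity for the Gram matrix of a unimodular
   matrix. *)
Lemma unimodular_split_gram m r s (L : 'M[int]_(m, r)) (L' : 'M_(r, m))
    (K : 'M_(s, m)) (K' : 'M_(m, s)) : unimodular_split L L' K K' ->
  \det (K *m K^T) = \det (L^T *m L).
Proof.
move=> [em L'L KL KK' L'K' sumE]; subst m.
pose U := row_mx L K'; pose V := col_mx L' K.
have VU : V *m U = 1%:M by rewrite mul_col_row L'L L'K' KL KK' -scalar_mx_block.
(* The determinant of [row_mx L K^T] is computed in two ways: multiplying it by [U^T] or by [V]
   gives a block triangular matrix with one Gram matrix and one identity on the diagonal. *)
have e1 : \det U * \det (row_mx L K^T) = \det (L^T *m L).
  rewrite -[\det U]det_tr -det_mulmx tr_row_mx mul_col_row -!trmx_mul KL trmx0.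
  by rewrite KK' trmx1 det_lblock det1 mulr1.
have e2 : \det V * \det (row_mx L K^T) = \det (K *m K^T).
  by rewrite -det_mulmx mul_col_row L'L KL det_ublock det1 mul1r.
have dVU : \det V * \det U = 1 by rewrite -det_mulmx VU det1.
have dV : \det V = \det U.
  have := intUnitRing.unitzPl dVU; rewrite unfold_in => /orP[] /eqP dU.
    by rewrite -[\det V]mulr1 -[1 in LHS]dU dVU.
  by move: dVU; rewrite dU mulrN1 => <-; rewrite opprK.
by rewrite -e1 -e2 dV.
Qed.

(* The rows of [smL]^T and [smN]^T are bases of the saturations of the column
   and row lattices of M, and those of [smK] and [smJ] of its left and right
   kernels. *)
Record smith m p (M : 'M[int]_(m, p)) := Smith {
  sm_rank : nat; sm_cork : nat; sm_nullity : nat;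
  smL : 'M[int]_(m, sm_rank); smL' : 'M[int]_(sm_rank, m);
  smK : 'M[int]_(sm_cork, m); smK' : 'M[int]_(m, sm_cork);
  smN : 'M[int]_(p, sm_rank); smN' : 'M[int]_(sm_rank, p);
  smJ : 'M[int]_(sm_nullity, p); smJ' : 'M[int]_(p, sm_nullity);
  smd : 'rV[int]_sm_rank;
  smE : M = smL *m diag_mx smd *m smN^T;
  smd_neq0 : forall i, smd 0 i != 0;
  smLP : unimodular_split smL smL' smK smK';
  smNP : unimodular_split smN smN' smJ smJ' }.

Lemma smith_exists m p (M : 'M[int]_(m, p)) : inhabited (smith M).
Proof.
have [L uL [R uR [d dsort ME]]] := int_Smith_normal_form M.
(* The rank is the first index where the diagonal vanishes, or [minn m p]. As each entry divides the
   next ones, all entries after a zero are zero. *)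
have [r [rm rp dn0 d0]] : exists r, [/\ (r <= m)%N, (r <= p)%N,
    forall i, (i < r)%N -> d`_i != 0 & forall i, (r <= i)%N -> (i < m)%N -> (i < p)%N -> d`_i = 0].
  have ex : exists i, (minn m p <= i)%N || (d`_i == 0) by exists (minn m p); rewrite leqnn.
  case: (ex_minnP ex) => r Hr minr.
  have rmin : (r <= minn m p)%N by apply: minr; rewrite leqnn.
  exists r; split.
  - exact: leq_trans rmin (geq_minl _ _).
  - exact: leq_trans rmin (geq_minr _ _).
  - move=> i ir; apply/negP => di; have := minr i; rewrite di orbT => /(_ isT).
    by rewrite leqNgt ir.
  move=> i ri im ip.
  have imin : (i < minn m p)%N by rewrite leq_min im ip.
  move: Hr; rewrite leqNgt (leq_ltn_trans ri imin) /= => /eqP dr.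
  have [sd|sd] := leqP (size d) i; first by rewrite nth_default.
  have /(sorted_leq_nth dvdz_trans dvdzz 0) := dsort.
  move=> /(_ r i); rewrite !inE => /(_ (leq_ltn_trans ri sd) sd ri).
  by rewrite dr dvd0z => /eqP.
have [s es] : exists s, m = (r + s)%N by exists (m - r)%N; rewrite subnKC.
have [t et] : exists t, p = (r + t)%N by exists (p - r)%N; rewrite subnKC.
subst m p.
pose dd : 'rV[int]_r := \row_i d`_i.
have uRT : R^T \in unitmx by rewrite unitmx_tr.
constructor; apply: (@Smith _ _ _ _ _ _ _ _ _ _ _ _ _ _ dd _ _
  (unimodular_split_unit uL) (unimodular_split_unit uRT)); last first.
  by move=> i; rewrite mxE dn0.
have -> : (lsubmx R^T)^T = usubmx R by rewrite -trmx_usub trmxK.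
rewrite {1}ME; have -> : \matrix_(i, j) (d`_i *+ (i == j :> nat)) =
   block_mx (diag_mx dd) 0 0 0 :> 'M[int]_(r + s, r + t).
  apply/matrixP => i j; rewrite !mxE.
  case: splitP => a ia; rewrite !mxE; case: splitP => b jb; rewrite !mxE ia jb.
  - by [].
  - by rewrite ltn_eqF// (leq_trans (ltn_ord a))// leq_addr.
  - by rewrite gtn_eqF// (leq_trans (ltn_ord b))// leq_addr.
  case: eqP => ab; rewrite ?mulr0n// d0 ?mul0rn//.
  - exact: leq_addr.
  - by rewrite -ia.
  - by rewrite ab -jb.
rewrite -{1}[L]hsubmxK -{1}[R]vsubmxK mul_row_block !mulmx0 !addr0 mul_row_col.
by rewrite mul0mx addr0.
Qed.

(** Kept transparent: the data of the transpose are those of [s] with the two sides exchanged, by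
    conversion. *)
Definition smith_tr m p (M : 'M[int]_(m, p)) (s : smith M) : smith M^T.
Proof.
apply: (@Smith _ _ _ _ _ _ _ _ _ _ _ _ _ _ (smd s) _ (@smd_neq0 _ _ _ s) (smNP s) (smLP s)).
by rewrite [LHS](congr1 trmx (smE s)) !trmx_mul trmxK tr_diag_mx mulmxA.
Defined.

(* Squared covolumes of the kernel and of the saturated image of the action of
   M on row vectors. *)
Definition ker_vol m p (M : 'M[int]_(m, p)) (s : smith M) := \det (smK s *m (smK s)^T).
Definition im_vol m p (M : 'M[int]_(m, p)) (s : smith M) := \det ((smN s)^T *m smN s).

Lemma ker_vol_tr m p (M : 'M[int]_(m, p)) (s : smith M) : ker_vol (smith_tr s) = im_vol s.
Proof. exact: (unimodular_split_gram (smNP s)). Qed.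

Lemma im_vol_tr m p (M : 'M[int]_(m, p)) (s : smith M) : im_vol (smith_tr s) = ker_vol s.
Proof. exact/esym/(unimodular_split_gram (smLP s)). Qed.

(** Multiplying [v *m M = 0] by the right inverse of [(smN s)^T] and cancelling the nonzero
    invariant factors gives [v *m smL s = 0]; the splitting of the identity then leaves only the
    [smK] part. *)
Lemma smith_kerP (R : numDomainType) m p (M : 'M[int]_(m, p)) (s : smith M) k
    (v : 'M[R]_(k, m)) : v *m map_mx intr M = 0 ->
  v = v *m map_mx intr (smK' s) *m map_mx intr (smK s).
Proof.
move=> vM; have [_ N'N _ _ _ _] := smNP s; have [_ _ _ _ _ sumE] := smLP s.
pose i0 (a b : nat) := @map_mx int R intr a b.
have vd : v *m i0 _ _ (smL s) *m i0 _ _ (diag_mx (smd s)) = 0.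
  have e : M *m (smN' s)^T = smL s *m diag_mx (smd s).
    rewrite [LHS](congr1 (mulmx^~ _) (smE s)) -[LHS]mulmxA -trmx_mul N'N trmx1.
    by rewrite mulmx1.
  by rewrite -mulmxA -map_mxM -e map_mxM mulmxA vM mul0mx.
have vL : v *m i0 _ _ (smL s) = 0.
  apply/matrixP => i j; have /matrixP/(_ i j) := vd.
  rewrite /i0 map_diag_mx mul_mx_diag !mxE => /eqP; rewrite mulf_eq0 intr_eq0.
  by rewrite (negPf (smd_neq0 _)) orbF => /eqP.
rewrite -{1}[v]mulmx1 -(map_mx1 intr) -sumE map_mxD !map_mxM.
by rewrite mulmxDr !mulmxA vL mul0mx add0r.
Qed.

Lemma smith_ker m p (M : 'M[int]_(m, p)) (s : smith M) : smK s *m M = 0.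
Proof.
have [_ _ KL _ _ _] := smLP s.
by rewrite [LHS](congr1 (mulmx _) (smE s)) !mulmxA KL !mul0mx.
Qed.

Lemma smith_imP m p q (M : 'M[int]_(m, p)) (s : smith M) (X : 'M[int]_(p, q)) :
  M *m X = 0 -> (smN s)^T *m X = 0.
Proof.
move=> MX; have [_ L'L _ _ _ _] := smLP s.
have : diag_mx (smd s) *m ((smN s)^T *m X) = 0.
  rewrite -[LHS]mul1mx -L'L -mulmxA [smL s *m _]mulmxA [_ *m (_ *m X)]mulmxA.
  by rewrite -(smE s) MX mulmx0.
move=> e; apply/matrixP => i j; have /matrixP/(_ i j) := e.
by rewrite mul_diag_mx !mxE => /eqP; rewrite mulf_eq0 (negPf (smd_neq0 _)) => /eqP.
Qed.

(** * Gram determinants and orthogonal projections *)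

Definition gram (R : comNzRingType) m n (Y : 'M[R]_(m, n)) := \det (Y *m Y^T).

Definition sqn (R : comNzRingType) n (v : 'rV[R]_n) := (v *m v^T) 0 0.

Lemma sqnE (R : comNzRingType) n (v : 'rV[R]_n) : sqn v = \sum_i v 0 i ^+ 2.
Proof. by rewrite /sqn mxE; apply: eq_bigr => i _; rewrite mxE expr2. Qed.

Lemma sqn_ge0 (R : realDomainType) n (v : 'rV[R]_n) : 0 <= sqn v.
Proof. by rewrite sqnE sumr_ge0// => i _; rewrite sqr_ge0. Qed.

Lemma sqn_eq0 (R : realDomainType) n (v : 'rV[R]_n) : (sqn v == 0) = (v == 0).
Proof.
rewrite sqnE psumr_eq0; last by move=> i _; rewrite sqr_ge0.
apply/allP/eqP => [h|-> i _]; last by rewrite /= mxE expr0n eqxx.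
apply/rowP => i; rewrite mxE; apply/eqP.
have := h i; rewrite mem_index_enum sqrf_eq0 => hi; exact: (hi isT).
Qed.

Lemma map_gram (R S : comNzRingType) (f : {rmorphism R -> S}) m n (Y : 'M[R]_(m, n)) :
  gram (map_mx f Y) = f (gram Y).
Proof. by rewrite /gram map_trmx -map_mxM det_map_mx. Qed.

Lemma map_sqn (R S : comNzRingType) (f : {rmorphism R -> S}) n (v : 'rV[R]_n) :
  sqn (map_mx f v) = f (sqn v).
Proof. by rewrite /sqn map_trmx -map_mxM mxE. Qed.

Lemma gram_cast (R : comNzRingType) m m' n (e : m = m') (Y : 'M[R]_(m, n)) :
  gram (castmx (e, erefl) Y) = gram Y.
Proof. by case: m' / e; rewrite castmx_id. Qed.

(** If [w *m Y *m Y^T = 0] then [w *m Y] has norm zero. Hence [Y *m Y^T] and [Y^T] have the same row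
    space, and the normal equations are solvable over any ordered field, in particular over
    [rat]. *)
Lemma orthogonal_projection (F : realFieldType) r m (Y : 'M[F]_(r, m)) (v : 'rV_m) :
  exists u : 'rV_r, (v - u *m Y) *m Y^T = 0.
Proof.
have le : (Y *m Y^T <= Y^T)%MS by rewrite submxMl.
have rk : \rank (Y *m Y^T) = \rank Y^T.
  rewrite mxrank_tr; apply/eqP; rewrite eqn_leq mxrankM_maxl /=.
  have /mxrankS : (kermx (Y *m Y^T) <= kermx Y)%MS.
    apply/rV_subP => w /sub_kermxP wY; apply/sub_kermxP/eqP; rewrite -sqn_eq0.
    by rewrite /sqn trmx_mul mulmxA -[w *m _ *m _]mulmxA wY mul0mx mxE.
  rewrite !mxrank_ker => h.
  by rewrite -(leq_sub2lE _ (rank_leq_row Y)).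
have : (v *m Y^T <= Y *m Y^T)%MS.
  apply: submx_trans (submxMl _ _) _.
  by rewrite -(mxrank_leqif_sup le) rk.
move=> /submxP[u uE]; exists u; rewrite mulmxBl uE mulmxA subrr.
by [].
Qed.

(** Base times height: a unipotent row operation replaces [v] by its component orthogonal to [Y],
    after which the Gram matrix is block triangular. *)
Lemma gram_top (R : comNzRingType) r m (Y : 'M[R]_(r, m)) (v : 'rV_m) (u : 'rV_r) :
  (v - u *m Y) *m Y^T = 0 ->
  gram (col_mx v Y) = sqn (v - u *m Y) * gram Y.
Proof.
move=> orth.
have -> : col_mx v Y = block_mx 1%:M u 0 1%:M *m col_mx (v - u *m Y) Y.
  by rewrite mul_block_col !mul1mx mul0mx add0r subrK.
rewrite /gram trmx_mul mulmxA -[block_mx _ _ _ _ *m _ *m _]mulmxA det_mulmx det_mulmx.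
rewrite det_tr det_ublock !det1 !mul1r mulr1 tr_col_mx mul_col_row orth.
by rewrite det_lblock [X in \det X]mx11_scalar det_scalar1.
Qed.

Lemma projection_min (F : realFieldType) r m (Y : 'M[F]_(r, m)) (v : 'rV_m) (u u' : 'rV_r) :
  (v - u *m Y) *m Y^T = 0 -> sqn (v - u *m Y) <= sqn (v - u' *m Y).
Proof.
move=> orth.
have -> : v - u' *m Y = (v - u *m Y) + (u - u') *m Y.
  by rewrite mulmxBl addrA subrK.
set a := v - _; set b := (u - u') *m Y.
have ab : a *m b^T = 0 by rewrite trmx_mul mulmxA orth mul0mx.
have ba : b *m a^T = 0 by rewrite -[b]trmxK -trmx_mul ab trmx0.
rewrite [sqn (a + b)]/sqn linearD /= mulmxDl !mulmxDr ab ba addr0 add0r mxE.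
by rewrite lerDl sqn_ge0.
Qed.

Lemma gram_ge0 (F : realFieldType) r m (Y : 'M[F]_(r, m)) : 0 <= gram Y.
Proof.
elim: r Y => [|r IH] Y; first by rewrite /gram det_mx00.
rewrite -[Y](@vsubmxK _ 1 r).
have [u orth] := orthogonal_projection (@dsubmx _ 1 r _ Y) (@usubmx _ 1 r _ Y).
by rewrite (gram_top orth) mulr_ge0 ?sqn_ge0.
Qed.

Lemma gram_top_le (F : realFieldType) r m (Y : 'M[F]_(r, m)) (v : 'rV_m) :
  gram (col_mx v Y) <= sqn v * gram Y.
Proof.
have [u orth] := orthogonal_projection Y v.
rewrite (gram_top orth) ler_wpM2r ?gram_ge0//.
by have := projection_min 0 orth; rewrite mul0mx subr0.
Qed.

Lemma gram_top_neq0 (F : realFieldType) r m (Y : 'M[F]_(r, m)) (v : 'rV_m) :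
  gram Y != 0 -> ~~ (v <= Y)%MS -> gram (col_mx v Y) != 0.
Proof.
move=> Y0 vY; have [u orth] := orthogonal_projection Y v.
rewrite (gram_top orth) mulf_neq0// sqn_eq0 subr_eq0.
by apply: contraNneq vY => ->; rewrite submxMl.
Qed.

(* Adding a row to W multiplies each of the two Gram determinants involving W
   by a squared distance, and D shrinks that distance by the factor c. *)
Lemma gram_mul_le (F : realFieldType) s t m p (c : F) (D : 'M[F]_(m, p))
    (W : 'M_(t, m)) (Z : 'M_(s, m)) :
  0 <= c -> (forall v : 'rV_m, sqn (v *m D) <= c * sqn v) -> Z *m D = 0 ->
  gram (W *m D) * gram Z <= c ^+ t * gram (col_mx W Z).
Proof.
move=> c0 cD ZD; elim: t W => [|t IH] W.
  rewrite /gram det_mx00 mul1r expr0 mul1r.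
  by rewrite tr_col_mx mul_col_row [X in block_mx _ X _ _]flatmx0 det_lblock det_mx00 mul1r.
rewrite -[W](@vsubmxK _ 1 t); set w := usubmx _; set W' := dsubmx _.
have -> : gram (col_mx (@col_mx _ 1 t _ w W') Z) = gram (col_mx w (col_mx W' Z)).
  by rewrite col_mxA gram_cast.
have [u orth] := orthogonal_projection (col_mx W' Z) w.
rewrite (gram_top orth) (@mul_col_mx _ 1 t).
have [u1 orth1] := orthogonal_projection (W' *m D) (w *m D).
rewrite (gram_top orth1).
(* The competitor for the minimum is the image under [D] of the projection of [w] on the rows of
   [W'] and [Z], whose [Z] part is killed by [D]. *)
have le1 : sqn (w *m D - u1 *m (W' *m D)) <= c * sqn (w - u *m col_mx W' Z).
  apply: le_trans (cD _); apply: le_trans (projection_min (lsubmx u) orth1) _.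
  rewrite mulmxBl -[X in _ - X *m _ *m D]hsubmxK mul_row_col mulmxDl -!mulmxA ZD.
  by rewrite mulmx0 addr0.
have := ler_pM (sqn_ge0 _) (mulr_ge0 (gram_ge0 _) (gram_ge0 _)) le1 (IH W').
by rewrite exprS !mulrA => h; rewrite [c * c ^+ t * _]mulrAC.
Qed.

Lemma unimodular_split_gramM m r s n (L : 'M[int]_(m, r)) (L' : 'M_(r, m))
    (K : 'M_(s, m)) (K' : 'M_(m, s)) (Y : 'M[int]_(m, n)) :
  unimodular_split L L' K K' -> gram (col_mx (L' *m Y) (K *m Y)) = gram Y.
Proof.
move=> [em L'L KL KK' L'K' sumE]; subst m.
rewrite -mul_col_mx /gram trmx_mul mulmxA -[_ *m Y *m _]mulmxA !det_mulmx det_tr.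
have : \det (row_mx L K') * \det (col_mx L' K) = 1.
  by rewrite mulrC -det_mulmx mul_col_row L'L L'K' KL KK' -scalar_mx_block det1.
move=> /intUnitRing.unitzPl; rewrite unfold_in => /orP[] /eqP ->.
  by rewrite mul1r mulr1.
by rewrite mulN1r mulrN1 opprK.
Qed.

(** The Gram determinant is multiplied by the square of the index [\det c], a nonzero integer. *)
Lemma gram_sublattice s s' m (c : 'M[int]_(s', s)) (b : 'M[rat]_(s, s')) (K : 'M[int]_(s, m)) :
  b *m map_mx intr c = 1%:M -> map_mx intr c *m b = 1%:M ->
  gram K <= gram (c *m K).
Proof.
move=> bc cb; have es : s = s' by apply/eqP; rewrite eqn_leq (mulmx1_min bc) (mulmx1_min cb).
subst s'.
have detc : \det c != 0.
  apply: contraTneq isT => c0; have := congr1 (@determinant _ _) bc.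
  by rewrite det_mulmx det_map_mx c0 mulr0 det1 => /esym/eqP; rewrite oner_eq0.
rewrite /gram trmx_mul mulmxA -[_ *m K *m _]mulmxA !det_mulmx det_tr mulrAC -expr2.
have K0 : 0 <= \det (K *m K^T).
  by rewrite -(ler_int rat) -/(gram K) -map_gram gram_ge0.
rewrite -[leLHS]mul1r ler_wpM2r//.
by rewrite -gtz0_ge1 // exprn_even_gt0.
Qed.

(** Greedy choice: a vector of [kap] is adjoined only when it is rationally independent of the rows
    already present. Skipping it preserves the bound, since a nonzero integral vector has squared
    norm at least 1. *)
Lemma gram_extend r m (Y : 'M[int]_(r, m)) (kap : seq 'rV[int]_m) :
  gram Y != 0 -> (forall x, x \in kap -> x != 0) ->
  exists k (X : 'M[int]_(k, m)),
    [/\ (k <= size kap)%N, gram (col_mx X Y) != 0,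
        gram (col_mx X Y) <= gram Y * \prod_(x <- kap) sqn x &
        forall x, x \in kap -> (map_mx intr x <= map_mx (intr : int -> rat) (col_mx X Y))%MS].
Proof.
move=> Y0; elim: kap => [|x kap IH] nz.
  exists 0%N, 0; have e : gram (col_mx (0 : 'M_(0, m)) Y) = gram Y.
    rewrite /gram tr_col_mx mul_col_row [X in block_mx _ X _ _]flatmx0.
    by rewrite det_lblock det_mx00 mul1r.
  by split=> //; rewrite ?e// big_nil mulr1.
have [y ykap|k [X [ksz gn0 gle sp]]] := IH; first by apply: nz; rewrite inE ykap orbT.
have x1 : 1 <= sqn x.
  by rewrite -gtz0_ge1 lt0r sqn_ge0 sqn_eq0 nz ?mem_head.
have gK0 : 0 <= gram (col_mx X Y) by rewrite -(ler_int rat) -map_gram gram_ge0.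
have gKx : gram (col_mx X Y) <= sqn x * gram (col_mx X Y) by rewrite ler_peMl.
have [xs|xs] := boolP (map_mx intr x <= map_mx (intr : int -> rat) (col_mx X Y))%MS.
  exists k, X; split=> //.
  - exact: leq_trans ksz _.
  - apply: le_trans gKx _; rewrite big_cons mulrCA ler_wpM2l//.
    exact: le_trans x1.
  by move=> y; rewrite inE => /orP[/eqP->|/sp].
have assoc : gram (col_mx (col_mx x X) Y) = gram (col_mx x (col_mx X Y)).
  by rewrite col_mxA gram_cast.
exists (1 + k)%N, (col_mx x X); rewrite assoc; split=> //.
- rewrite -(intr_eq0 rat) -map_gram map_col_mx gram_top_neq0//.
  by rewrite map_gram intr_eq0.
- rewrite big_cons mulrCA.
  apply: (@le_trans _ _ (sqn x * gram (col_mx X Y))); last by rewrite ler_wpM2l// sqn_ge0.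
  rewrite -(ler_int rat) -map_gram map_col_mx.
  by apply: le_trans (gram_top_le _ _) _; rewrite intrM map_sqn map_gram.
have sub : (map_mx (intr : int -> rat) (col_mx x (col_mx X Y)) <=
            map_mx intr (col_mx (col_mx x X) Y))%MS.
  by rewrite col_mxA castmx_id.
move=> y; rewrite inE => /orP[/eqP->|/sp ys]; apply: submx_trans sub.
  by rewrite map_col_mx -addsmxE addsmxSl.
by apply: (submx_trans ys); rewrite [X in (_ <= X)%MS]map_col_mx -addsmxE addsmxSr.
Qed.

(** * Comparing the covolumes of kernel and image *)

Lemma im_vol_gram m p (M : 'M[int]_(m, p)) (s : smith M) : im_vol s = gram (smN s)^T.
Proof. by rewrite /gram trmxK. Qed.

Lemma split_gram_neq0 m r s (L : 'M[int]_(m, r)) (L' : 'M_(r, m))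
    (K : 'M_(s, m)) (K' : 'M_(m, s)) : unimodular_split L L' K K' -> gram L^T != 0.
Proof.
move=> [_ L'L _ _ _ _].
have gN : kermx (map_mx (intr : int -> rat) L^T *m map_mx intr L) = 0.
  apply/row_matrixP => i; rewrite row0; set w := row i _.
  have : w *m (map_mx (intr : int -> rat) L^T *m map_mx intr L) = 0.
    by rewrite /w -row_mul mulmx_ker row0.
  move=> wL; have : w *m map_mx intr L^T == 0.
    rewrite -sqn_eq0 /sqn trmx_mul map_trmx trmxK mulmxA -[w *m _ *m _]mulmxA wL.
    by rewrite mul0mx mxE.
  move=> /eqP/(congr1 (mulmx^~ (map_mx intr L'^T))).
  by rewrite -mulmxA -map_mxM -trmx_mul L'L trmx1 map_mx1 mulmx1 mul0mx.
have : row_free (map_mx (intr : int -> rat) (L^T *m L)).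
  by rewrite map_mxM -kermx_eq0 gN.
rewrite row_free_unit unitmxE det_map_mx unitfE intr_eq0 => h.
by rewrite /gram trmxK.
Qed.

Lemma map_intr_mx_inj m n : injective (map_mx (intr : int -> rat) : 'M_(m, n) -> _).
Proof.
by move=> X Y /matrixP e; apply/matrixP => i j; have := e i j; rewrite !mxE => /intr_inj.
Qed.

Lemma mul_col_mx_eq0 (R : comNzRingType) k r m t (X : 'M[R]_(k, m)) (Y : 'M_(r, m))
    (E : 'M_(m, t)) : Y *m E = 0 -> col_mx 1%:M 0 *m (X *m E) = col_mx X Y *m E.
Proof. by move=> YE; rewrite !mul_col_mx mul1mx mul0mx YE. Qed.

(** Adjoining [kap] to a basis of the saturated image of [A] gives a lattice whose rational span
    contains the kernel of [D]. [gram_extend] controls its covolume, and [gram_mul_le] carries the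
    bound over to its sublattice killed by [D], which has finite index in the kernel lattice. *)
Lemma ker_vol_bound m p l (D : 'M[int]_(m, p)) (A : 'M[int]_(l, m)) (sD : smith D)
    (sA : smith A) (c : nat) (kap : seq 'rV[int]_m) :
  (0 < c)%N -> A *m D = 0 ->
  (forall v : 'rV[rat]_m, sqn (v *m map_mx intr D) <= c%:R * sqn v) ->
  (forall x, x \in kap -> x != 0) ->
  (forall v : 'rV[rat]_m, v *m map_mx intr D = 0 ->
    (v <= map_mx intr A + \sum_(x <- kap) <<map_mx intr x>>)%MS) ->
  ker_vol sD <= c%:Z ^+ size kap * im_vol sA * \prod_(x <- kap) sqn x.
Proof.
move=> c0 AD cD nz span.
set Y := (smN sA)^T; have Y0 : gram Y != 0 := split_gram_neq0 (smNP sA).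
have YD : Y *m D = 0 := smith_imP sA AD.
have [k [X [ksz g0 gle sp]]] := gram_extend Y0 nz.
set Y' := col_mx X Y in g0 gle sp.
have [sM] := smith_exists (Y' *m D).
have spanY' (v : 'rV[rat]_m) : v *m map_mx intr D = 0 -> (v <= map_mx intr Y')%MS.
  move=> /span /submx_trans; apply; rewrite addsmx_sub; apply/andP; split.
    rewrite [A in map_mx _ A](smE sA) map_mxM; apply: submx_trans (submxMl _ _) _.
    by rewrite /Y' map_col_mx -addsmxE addsmxSr.
  rewrite big_seq; apply: (big_ind (fun Z => (Z <= map_mx intr Y')%MS)).
  - exact: sub0mx.
  - by move=> Z1 Z2 h1 h2; rewrite addsmx_sub h1 h2.
  by move=> x /sp; rewrite genmxE.
(* A basis of the lattice spanned by Y' whose part Z spans the kernel of D, while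
   the rows of W *m D are integral and independent, so that gram (W *m D) >= 1. *)
set W := smL' sM *m Y'; set Z := smK sM *m Y'.
have gWZ : gram (col_mx W Z) = gram Y' := unimodular_split_gramM _ (smLP sM).
have ZD : Z *m D = 0 by rewrite -mulmxA smith_ker.
have WD : W *m D = diag_mx (smd sM) *m (smN sM)^T.
  have [_ L'L _ _ _ _] := smLP sM.
  by rewrite -mulmxA [LHS](congr1 (mulmx _) (smE sM)) !mulmxA L'L mul1mx.
have gWD : 1 <= gram (W *m D).
  rewrite -gtz0_ge1 lt0r -(ler_int rat) -map_gram gram_ge0 andbT WD /gram trmx_mul.
  rewrite mulmxA -[diag_mx _ *m _ *m _]mulmxA !det_mulmx det_tr det_diag.
  have nz2 : \prod_i smd sM 0 i != 0 by apply/prodf_neq0 => i _; exact: smd_neq0.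
  by rewrite !mulf_neq0// (split_gram_neq0 (smNP sM)).
(* [D] kills the rows of [Y], so only the [k] adjoined rows contribute to the rank of [Y' *m D].
   Thus the exponent of [c] is bounded by the size of [kap] and not by [m]. *)
have tk : (sm_rank sM <= k)%N.
  have [_ N'N _ _ _ _] := smNP sM.
  have e : smL' sM *m col_mx 1%:M 0 *m (X *m D *m (smN' sM)^T) = diag_mx (smd sM).
    transitivity (W *m D *m (smN' sM)^T); last first.
      by rewrite WD -mulmxA -trmx_mul N'N trmx1 mulmx1.
    rewrite /W -[in RHS]mulmxA -!mulmxA; congr (_ *m _).
    have : Y *m (D *m (smN' sM)^T) = 0 by rewrite mulmxA YD mul0mx.
    exact: mul_col_mx_eq0.
  have rk : \rank (map_mx (intr : int -> rat) (diag_mx (smd sM))) = sm_rank sM.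
    apply/eqP; rewrite -/(row_free _) row_free_unit unitmxE det_map_mx det_diag unitfE.
    by rewrite intr_eq0; apply/prodf_neq0 => i _; exact: smd_neq0.
  rewrite -rk -e map_mxM; apply: leq_trans (mxrankM_maxr _ _) _.
  exact: rank_leq_row.
have gZ0 : 0 <= gram Z by rewrite -(ler_int rat) -map_gram gram_ge0.
have gZ : gram Z <= c%:Z ^+ size kap * gram Y'.
  rewrite -(ler_int rat) intrM -!map_gram.
  apply: (@le_trans _ _ (gram (map_mx intr (W *m D)) * gram (map_mx intr Z))).
    rewrite ler_peMl ?gram_ge0// map_gram.
    by rewrite -[1]/((1 : int)%:~R) ler_int.
  rewrite map_mxM; apply: le_trans (gram_mul_le (c := c%:R) _ _ cD _) _ => //.
    by rewrite -map_mxM ZD map_mx0.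
  rewrite -map_col_mx !map_gram gWZ ler_wpM2r//.
    by rewrite -map_gram gram_ge0.
  rewrite rmorphXn /= ler_weXn2l//; first by rewrite ler1n.
  exact: leq_trans tk ksz.
have [_ _ _ KK' _ _] := smLP sD.
have [_ _ _ KMK' _ _] := smLP sM.
(* The rows of [Z] are integral combinations of the kernel basis [smK sD]; expressing that basis
   rationally in [Y'] gives an inverse [b] of the matrix of coefficients. *)
have le1 : ker_vol sD <= gram Z.
  have ZE : Z = Z *m smK' sD *m smK sD.
    apply: map_intr_mx_inj; rewrite !map_mxM /=.
    by apply: smith_kerP; rewrite -map_mxM -map_mxM ZD map_mx0.
  have [u uE] : exists u, u *m map_mx (intr : int -> rat) Y' = map_mx intr (smK sD).
    suff /submxP[u ->] : (map_mx (intr : int -> rat) (smK sD) <= map_mx intr Y')%MS.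
      by exists u.
    apply/row_subP => i; apply: spanY'.
    by rewrite -row_mul -map_mxM smith_ker map_mx0 row0.
  have uM : u *m map_mx intr (Y' *m D) = 0.
    by rewrite map_mxM mulmxA uE -map_mxM smith_ker map_mx0.
  have uE2 := smith_kerP sM uM.
  set b := u *m map_mx intr (smK' sM).
  have bZ : b *m map_mx intr Z = map_mx intr (smK sD).
    by rewrite /Z map_mxM mulmxA /b -uE2 uE.
  have bc : b *m map_mx intr (Z *m smK' sD) = 1%:M.
    by rewrite map_mxM mulmxA bZ -map_mxM KK' map_mx1.
  have cb : map_mx intr (Z *m smK' sD) *m b = 1%:M.
    have e : (map_mx intr (Z *m smK' sD) *m b - 1%:M) *m map_mx intr Z = 0.
      by rewrite mulmxBl mul1mx -mulmxA bZ -map_mxM -ZE subrr.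
    have gYf : row_free (map_mx (intr : int -> rat) Y').
      rewrite -kermx_eq0; apply/eqP/row_matrixP => i; rewrite row0; set w := row i _.
      have : w *m map_mx (intr : int -> rat) Y' = 0.
        by rewrite /w -row_mul mulmx_ker row0.
      have : row_free (map_mx (intr : int -> rat) (Y' *m Y'^T)).
        by rewrite row_free_unit unitmxE det_map_mx unitfE intr_eq0.
      rewrite -kermx_eq0 => /eqP kg wY.
      have : (w <= kermx (map_mx (intr : int -> rat) (Y' *m Y'^T)))%MS.
        by apply/sub_kermxP; rewrite map_mxM mulmxA wY mul0mx.
      by rewrite kg submx0 => /eqP.
    have PK : (map_mx intr (Z *m smK' sD) *m b - 1%:M) *m map_mx intr (smK sM) = 0.
      by apply: (row_free_inj gYf); rewrite mul0mx -mulmxA -map_mxM.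
    move/(congr1 (mulmx^~ (map_mx intr (smK' sM)))): PK.
    by rewrite -mulmxA -map_mxM KMK' map_mx1 mulmx1 mul0mx => /eqP; rewrite subr_eq0 => /eqP.
  by rewrite [in leRHS]ZE; exact: gram_sublattice bc cb.
apply: (le_trans le1); apply: (le_trans gZ).
by rewrite -mulrA ler_wpM2l ?im_vol_gram// exprn_ge0.
Qed.

Lemma im_vol_gt0 m p (M : 'M[int]_(m, p)) (s : smith M) : 0 < im_vol s.
Proof.
rewrite im_vol_gram lt0r (split_gram_neq0 (smNP s)) -(ler_int rat) -map_gram.
exact: gram_ge0.
Qed.

Lemma ker_vol_gt0 m p (M : 'M[int]_(m, p)) (s : smith M) : 0 < ker_vol s.
Proof. by rewrite -im_vol_tr im_vol_gt0. Qed.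

(** * Torsion of a complex and covolumes *)

(** Sylvester's identity: the block matrix [B] is made triangular by two different eliminations, and
    the determinants are compared. *)
Lemma char_poly_mulmxC (R : comNzRingType) m r (X : 'M[R]_(m, r)) (Y : 'M[R]_(r, m)) :
  'X^r * char_poly (X *m Y) = 'X^m * char_poly (Y *m X).
Proof.
pose f k l (A : 'M[R]_(k, l)) := map_mx (@polyC R) A.
pose B := block_mx 'X%:M (f _ _ X) (f _ _ Y) 1%:M.
have e1 : block_mx 1%:M (- f _ _ X) 0 1%:M *m B =
    block_mx (char_poly_mx (X *m Y)) 0 (f _ _ Y) 1%:M.
  rewrite mulmx_block !mul1mx !mul0mx !add0r !mulmx1 subrr; congr block_mx.
  by rewrite mulNmx -map_mxM.
have e2 : block_mx 1%:M 0 (- f _ _ Y) 'X%:M *m B =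
    block_mx 'X%:M (f _ _ X) 0 (char_poly_mx (Y *m X)).
  rewrite mulmx_block !mul1mx !mul0mx !addr0 !mulmx1; congr block_mx.
    by rewrite mulNmx scalar_mxC addNr.
  by rewrite mulNmx -map_mxM addrC.
have d1 : \det B = char_poly (X *m Y).
  have := congr1 (@determinant _ _) e1.
  by rewrite det_mulmx det_ublock det_lblock !det1 !mul1r mulr1.
have := congr1 (@determinant _ _) e2.
by rewrite det_mulmx det_lblock det_ublock det1 mul1r !det_scalar d1.
Qed.

Lemma polyXn_mul_inj (F : idomainType) a b (p q : {poly F}) :
  p.[0] != 0 -> q.[0] != 0 -> 'X^a * p = 'X^b * q -> a = b /\ p = q.
Proof.
wlog le : a b p q / (a <= b)%N => [H p0 q0 e|p0 q0].
  case: (leqP a b) => [|/ltnW] le; first exact: H.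
  by have [-> ->] := H b a q p le q0 p0 (esym e).
rewrite -(subnKC le) exprD -mulrA => /mulfI; rewrite expf_neq0 ?polyX_eq0// => /(_ isT) e.
have d0 : (b - a = 0)%N.
  apply/eqP; apply: contraNT p0 => d0.
  by rewrite e hornerM hornerXn expr0n (negPf d0) mul0r.
by split; rewrite ?e d0 ?addn0 ?expr0 ?mul1r.
Qed.

Lemma char_poly_simmx (R : fieldType) n (P A B : 'M[R]_n) :
  P \in unitmx -> A = invmx P *m B *m P -> char_poly A = char_poly B.
Proof.
move=> uP ->; rewrite /char_poly /char_poly_mx.
have e : 'X%:M = map_mx (@polyC R) (invmx P) *m 'X%:M *m map_mx (@polyC R) P.
  by rewrite scalar_mxC -mulmxA -map_mxM mulVmx// map_mx1 mulmx1.
rewrite [in LHS]e !map_mxM -mulmxBl -mulmxBr !det_mulmx mulrAC -det_mulmx -map_mxM mulVmx//.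
by rewrite map_mx1 det1 mul1r.
Qed.

(** Up to sign, the product of the nonzero eigenvalues is the lowest nonzero coefficient of the
    characteristic polynomial. By Sylvester's identity it is the constant coefficient for [Y *m X],
    which is invertible. *)
Lemma prod_spectral_diag (C : numClosedFieldType) m r (X : 'M[C]_(m, r)) (Y : 'M[C]_(r, m)) :
  X *m Y \is normalmx -> \det (Y *m X) != 0 ->
  \prod_(j | spectral_diag (X *m Y) 0 j != 0) spectral_diag (X *m Y) 0 j = \det (Y *m X).
Proof.
move=> /orthomx_spectralP; set sp := spectral_diag _ => /(char_poly_simmx (spectral_unit _)) e d0.
have cE : char_poly (X *m Y) = \prod_j ('X - (sp 0 j)%:P).
  rewrite e char_poly_trig ?diag_mx_is_trig//.
  by apply: eq_bigr => j _; rewrite mxE eqxx mulr1n.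
pose z := #|[pred j | sp 0 j == 0]|.
pose Q := \prod_(j | sp 0 j != 0) ('X - (sp 0 j)%:P).
have Q0 : Q.[0] = (-1) ^+ (m - z) * \prod_(j | sp 0 j != 0) sp 0 j.
  rewrite /Q horner_prod.
  transitivity (\prod_(j | sp 0 j != 0) (- sp 0 j)).
    by apply: eq_bigr => j _; rewrite !hornerE.
  rewrite prodrN; congr (_ ^+ _ * _).
  have zm : (z <= m)%N by apply: leq_trans (max_card _) _; rewrite card_ord.
  apply: (@addnI z); rewrite subnKC// -[RHS](card_ord m).
  exact: (cardC [pred j | sp 0 j == 0]).
have cQ : char_poly (X *m Y) = 'X^z * Q.
  rewrite cE (bigID (fun j => sp 0 j == 0)) /=; congr (_ * _).
  rewrite -prodr_const; apply: eq_big => [//|j /eqP ->].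
  by rewrite subr0.
have C0 : (char_poly (Y *m X)).[0] = (-1) ^+ r * \det (Y *m X).
  by rewrite horner_coef0 char_poly_det.
have := char_poly_mulmxC X Y; rewrite cQ mulrA -exprD => /polyXn_mul_inj [].
- rewrite Q0 mulf_neq0 ?signr_eq0//; exact/prodf_neq0.
- by rewrite C0 mulf_neq0 ?signr_eq0.
move=> em eQ; have := congr1 (fun p => p.[0]) eQ; rewrite Q0 C0.
have -> : (m - z = r)%N by rewrite -em addnK.
by move=> /(mulfI _); apply; rewrite signr_eq0.
Qed.

Lemma spectral_diag_gram_ge0 (C : numClosedFieldType) m p (A : 'M[C]_(m, p)) j :
  0 <= spectral_diag (A *m (A ^t*)%sesqui) 0 j.
Proof.
have nA : A *m (A ^t*)%sesqui \is normalmx.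
  apply: hermitian_normalmx; apply/is_hermitianmxP.
  by rewrite expr0 scale1r trmx_mul map_mxM trmxCK.
have /orthomx_spectralP := nA.
set P := spectralmx _; set sp := spectral_diag _ => e.
have uP : P \is unitarymx := spectral_unitarymx _.
have : diag_mx sp = P *m A *m ((P *m A) ^t*)%sesqui.
  rewrite trmx_mul map_mxM mulmxA -[P *m A *m _]mulmxA e -(invmx_unitary uP).
  by rewrite mulmxA mulmxK ?spectral_unit// mulmxA mulmxV ?spectral_unit// mul1mx.
move=> /matrixP/(_ j j); rewrite mxE eqxx mulr1n => ->; rewrite mxE.
by apply: sumr_ge0 => k _; rewrite !mxE mul_conjC_ge0.
Qed.

Lemma det'_gt0 (R : realType) m p (A : 'M[R[i]]_(m, p)) : 0 < det' A.
Proof. by apply: prodr_gt0 => j; rewrite lt0r => ->; exact: sqrtr_ge0. Qed.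

(** [A *m A^t*] factors as [X *m Y] through the rank of [M]. The determinant of [Y *m X] is a
    product of diagonal and Gram determinants, among them that of [smL], which equals [ker_vol] by
    Jacobi's identity. *)
Lemma det'_smith (R : realType) m p (M : 'M[int]_(m, p)) (s : smith M) :
  det' (map_mx (intr : int -> R[i]) M) ^+ 2 =
  (ker_vol s * im_vol s * (\prod_i smd s 0 i) ^+ 2)%:~R.
Proof.
set A := map_mx _ M.
pose toC k l (B : 'M[int]_(k, l)) := map_mx (intr : int -> R[i]) B.
pose X := toC _ _ (smL s *m diag_mx (smd s)).
pose Y := toC _ _ ((smN s)^T *m smN s *m diag_mx (smd s) *m (smL s)^T).
have AE : A *m (A ^t*)%sesqui = X *m Y.
  have -> : (A ^t*)%sesqui = toC _ _ M^T.
    by apply/matrixP => i j; rewrite !mxE rmorph_int.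
  rewrite -map_mxM -map_mxM; congr map_mx.
  have -> : M^T = smN s *m diag_mx (smd s) *m (smL s)^T.
    by rewrite [LHS](congr1 trmx (smE s)) !trmx_mul trmxK tr_diag_mx mulmxA.
  by rewrite [LHS](congr1 (mulmx^~ _) (smE s)) !mulmxA.
have nA : X *m Y \is normalmx.
  rewrite -AE; apply: hermitian_normalmx; apply/is_hermitianmxP.
  by rewrite expr0 scale1r trmx_mul map_mxM trmxCK.
have dE : \det (Y *m X) = (ker_vol s * im_vol s * (\prod_i smd s 0 i) ^+ 2)%:~R.
  rewrite -map_mxM det_map_mx; congr (_%:~R).
  rewrite -[_ *m (smL s *m _)]mulmxA [(smL s)^T *m _]mulmxA.
  rewrite /ker_vol /im_vol !det_mulmx !det_diag (unimodular_split_gram (smLP s)).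
  ring.
have d0 : \det (Y *m X) != 0.
  have nz : \prod_i smd s 0 i != 0 by apply/prodf_neq0 => i _; exact: smd_neq0.
  rewrite dE intr_eq0 !mulf_neq0//.
    exact: lt0r_neq0 (ker_vol_gt0 s).
  exact: lt0r_neq0 (im_vol_gt0 s).
have := prod_spectral_diag nA d0; rewrite dE -AE => spE.
apply: complexI; rewrite rmorphXn /= rmorph_int -spE /det' rmorph_prod -prodrXl.
have sp_real j : (complex.Re (spectral_diag (A *m (A ^t*)%sesqui) 0 j))%:C%C =
    spectral_diag (A *m (A ^t*)%sesqui) 0 j.
  by rewrite RRe_real// ger0_real// spectral_diag_gram_ge0.
have Re_ge0 j : 0 <= complex.Re (spectral_diag (A *m (A ^t*)%sesqui) 0 j).
  by rewrite -ler0c sp_real spectral_diag_gram_ge0.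
apply: eq_big => j.
  rewrite /singular_value sqrtr_eq0 -ltNge lt0r Re_ge0 andbT; congr (~~ _).
  by rewrite -[in RHS]sp_real -(inj_eq (@complexI R)).
by move=> _; rewrite /singular_value -rmorphXn /= sqr_sqrtr.
Qed.

(** The torsion classes are those of cycles in the saturation of the boundary lattice. In the basis
    [N] of this saturation, a vector is a boundary when each coordinate is divisible by the
    corresponding invariant factor, so the residues enumerate the torsion. *)
Lemma card_torsion (E : based_complex int) k (s : smith (bd E k)) :
  #|` fset_set (torsion_subgroup (homology E k))| = (\prod_i `|smd s 0%R i|)%N.
Proof.
have [_ N'N JN JJ' N'J' sumN] := smNP s.
have [_ L'L _ _ _ _] := smLP s.
pose r := sm_rank s; pose N := (smN s)^T.
have ND : N *m differential E k = 0.
  apply: smith_imP; case: (k) => [|k']; first by rewrite mulmx0.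
  exact: bdK.
have cyc (u : 'rV[int]_r) : u *m N \in cycle_pred (C := E) (k := k).
  by rewrite unfold_in -mulmxA ND mulmx0.
pose z u := Cycle (cyc u).
have zB u v : z (u - v) = z u - z v.
  by apply: val_inj; rewrite [RHS]raddfB /= mulmxBl.
have zbd u : (is_boundary (z u)) = [forall i, (smd s 0%R i %| u 0%R i)%Z].
  apply/asboolP/forallP => [[c cE] i|dv].
    have : u = c *m smL s *m diag_mx (smd s).
      transitivity (u *m N *m (smN' s)^T).
        by rewrite -mulmxA -trmx_mul N'N trmx1 mulmx1.
      have -> : u *m N = c *m bd E k by rewrite -cE.
      rewrite -[LHS]mulmxA -[RHS]mulmxA; congr (_ *m _).
      rewrite [LHS](congr1 (mulmx^~ _) (smE s)) -[LHS]mulmxA -trmx_mul N'N trmx1.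
      by rewrite mulmx1.
    by move=> ->; rewrite mul_mx_diag mxE dvdz_mull.
  pose q : 'rV[int]_r := \row_i (u 0%R i %/ smd s 0%R i)%Z.
  exists (q *m smL' s); rewrite [RHS](congr1 (mulmx _) (smE s)).
  rewrite !mulmxA -[q *m _ *m _]mulmxA L'L mulmx1; congr (_ *m _).
  by apply/rowP => i; rewrite mul_mx_diag !mxE divzK.
pose pi : {additive cycle_sub E k -> homology E k} :=
  \pi_(Quotient.quot (@is_boundary _ E k))%qT.
have pi0 x : (pi x == 0) = is_boundary x.
  by rewrite -[x in RHS]subr0 -(raddf0 pi); apply/esym/Quotient.idealrBE.
have zMn u n : z u *+ n = z (u *+ n).
  by apply: val_inj; rewrite raddfMn /= -!scaler_nat -scalemxAl.
pose T := {dffun forall i : 'I_r, 'I_(`|smd s 0%R i|%N)}.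
pose f (g : T) : homology E k := pi (z (\row_i ((g i : nat)%:Z))).
have finj : injective f.
  move=> g h /eqP; rewrite -subr_eq0 -raddfB -zB pi0 zbd => /forallP e.
  apply/ffunP => i; apply: val_inj; have := e i; rewrite !mxE.
  rewrite -eqz_mod_dvd => /eqP; rewrite -!(modz_abs _ (smd s 0 i)).
  by rewrite !modz_nat !modn_small// => -[].
have fT x : torsion_subgroup (homology E k) x <-> exists g, f g = x.
  split=> [[m m0]|[g <-]]; last first.
    exists (\prod_i `|smd s 0%R i|)%N.
      by rewrite prodn_gt0// => i; rewrite absz_gt0 smd_neq0.
    rewrite /f -raddfMn; apply/eqP; rewrite pi0 zMn zbd; apply/forallP => i.
    rewrite mulmxnE mxE -mulr_natr dvdz_mull// (bigD1 i)//= natrM dvdz_mulr//.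
    by rewrite natz dvdzE absz_nat.
  have : exists y, pi y = x by exists (repr x); exact: reprK.
  move=> [y <-]; rewrite -raddfMn => /eqP; rewrite pi0 => /asboolP[c cE].
  have cM : cycle_val y *+ m = c *m bd E k by rewrite -cE raddfMn.
  pose u := cycle_val y *m (smN' s)^T.
  (* A positive multiple of [y] is a boundary, hence is killed by [(smJ s)^T]. Then so is [y], which
     therefore lies in the saturation. *)
  have yE : y = z u.
    apply: val_inj; rewrite /= /u.
    have yJ : cycle_val y *m (smJ s)^T = 0.
      have : cycle_val y *m (smJ s)^T *+ m = 0.
        rewrite -scaler_nat scalemxAl scaler_nat cM -mulmxA.
        rewrite [X in _ *m X](congr1 (mulmx^~ _) (smE s)) -[X in _ *m X]mulmxA.
        by rewrite -trmx_mul JN trmx0 !mulmx0.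
      move=> /matrixP e; apply/matrixP => i j; have := e i j.
      rewrite mulmxnE [X in _ = X]mxE => /eqP.
      by rewrite mulrn_eq0 -leqn0 leqNgt m0 => /eqP ->; rewrite mxE.
    have := congr1 trmx sumN; rewrite linearD /= !trmx_mul trmx1 => e.
    rewrite -[LHS]mulmx1 -e mulmxDr !mulmxA yJ mul0mx addr0.
    by [].
  clearbody u.
  have lt i : (`|(u 0%R i %% smd s 0%R i)%Z| < `|smd s 0%R i|)%N.
    rewrite -ltz_nat gez0_abs ?modz_ge0 ?smd_neq0//.
    by rewrite abszE ltz_mod ?smd_neq0.
  exists (finfun (fun i => Ordinal (lt i)) : T); apply/eqP.
  rewrite yE -subr_eq0 -raddfB -zB pi0 zbd; apply/forallP => i.
  rewrite !mxE ffunE /= gez0_abs ?modz_ge0 ?smd_neq0// -eqz_mod_dvd.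
  by rewrite modz_mod.
have finT : finite_set (torsion_subgroup (homology E k)).
  apply: (@sub_finite_set _ _ (f @` [set: T])); first by move=> x /fT[g <-]; exists g.
  exact/finite_image/finite_finset.
have -> : fset_set (torsion_subgroup (homology E k)) = [fset x in codom f]%fset.
  apply/fsetP => x; rewrite in_fset_set// !inE /=.
  apply/idP/idP; first by rewrite inE => /fT[g <-]; rewrite codom_f.
  by move=> /codomP[g ->]; rewrite inE; apply/fT; exists g.
rewrite card_fseq undup_id; last exact/injectiveP.
rewrite size_map -cardE.
rewrite card_dep_ffun.
by rewrite foldrE big_map big_enum; apply: eq_bigr => i _; rewrite card_ord.
Qed.

Lemma ln_exprz_sign (R : realType) (x : R) k : 0 < x ->
  ln (x ^ ((-1) ^+ k : int)) = (-1) ^+ k * ln x.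
Proof.
move=> x0; rewrite -signr_odd -[in RHS]signr_odd; case: (odd k); rewrite /= ?expr1 ?expr0.
  by rewrite mulN1r exprN1 lnV.
by rewrite mul1r expr1z.
Qed.

Lemma alt_prod_gt0 (R : realType) (E : based_complex int) (a : nat -> R) :
  (forall k, 0 < a k) -> 0 < alt_prod E a.
Proof. by move=> a0; apply: prodr_gt0 => k _; exact: exprz_gt0. Qed.

Lemma ln_alt_prod (R : realType) (E : based_complex int) (a : nat -> R) :
  (forall k, 0 < a k) ->
  ln (alt_prod E a) = \sum_(k < (clength E).+1) (-1) ^+ k * ln (a k).
Proof.
move=> a0; rewrite /alt_prod; elim: _.+1 => [|m IH].
  by rewrite !big_ord0 ln1.
rewrite !big_ord_recr /= lnM ?IH ?ln_exprz_sign// posrE ?exprz_gt0//.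
by apply: prodr_gt0 => k _; exact: exprz_gt0.
Qed.

Lemma alt_sum_telescope (R : pzRingType) (a : nat -> R) l :
  \sum_(k < l.+1) (-1) ^+ k * (a k + a k.+1) = a 0%N + (-1) ^+ l * a l.+1.
Proof.
elim: l => [|l IH]; first by rewrite big_ord_recr big_ord0 /= add0r !mul1r.
by rewrite big_ord_recr /= IH mulrDr exprS -!mulrA !mulN1r addrA addrK.
Qed.

Lemma smith_rank0 m p (M : 'M[int]_(m, p)) (s : smith M) : (m == 0)%N || (p == 0)%N ->
  sm_rank s = 0%N.
Proof.
move=> mp0; apply/eqP; rewrite -leqn0; case/orP: mp0 => /eqP/eq_leq; apply: leq_trans.
  by have [em _ _ _ _ _] := smLP s; apply: leq_trans (leq_addr _ _) (eq_leq (esym em)).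
by have [ep _ _ _ _ _] := smNP s; apply: leq_trans (leq_addr _ _) (eq_leq (esym ep)).
Qed.

Lemma smith_rank0_im_vol m p (M : 'M[int]_(m, p)) (s : smith M) :
  sm_rank s = 0%N -> im_vol s = 1 /\ (\prod_i `|smd s 0%R i|)%N = 1%N.
Proof.
case: s => r k t L L' K K' N N' J J' d ME d0 LP NP /= r0; subst r.
by rewrite /im_vol /= det_mx00 big_ord0.
Qed.

Lemma ln_sqr_split (R : realType) (x a b c : R) : 0 < x -> 0 < c -> 0 < a -> 0 < b ->
  x ^+ 2 = a * b * c ^+ 2 -> ln x = ln c + (ln a + ln b) / 2.
Proof.
move=> x0 c0 a0 b0 /(congr1 (@ln R)).
rewrite lnXn// lnM ?posrE ?mulr_gt0 ?exprn_gt0// lnM ?posrE// lnXn//.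
by move: (ln x) (ln a) (ln b) (ln c) => y u v w; lra.
Qed.

(** The invariant factors enter the torsion of the homology in degree [k] through the differential
    of degree [k.+1], and [det'] through that of degree [k]. Their contributions telescope, and so
    do the image covolumes after a shift of degree. *)
Lemma ln_torsion_difference (R : realType) (E : based_complex int)
    (s : forall k, smith (differential E k)) :
  ln (homology_torsion R E) - ln (ray_singer_torsion R E) =
  - (\sum_(k < (clength E).+1)
      (-1) ^+ k * (ln (ker_vol (s k))%:~R - ln (im_vol (s k.+1))%:~R)) / 2.
Proof.
pose t k : nat := (\prod_i `|smd (s k) 0%R i|)%N.
have t_gt0 k : 0 < (t k)%:R :> R.
  by rewrite ltr0n prodn_gt0// => i; rewrite absz_gt0 smd_neq0.
pose lt k : R := ln (t k)%:R.
pose lk k : R := ln (ker_vol (s k))%:~R.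
pose li k : R := ln (im_vol (s k))%:~R.
have tE k : #|` fset_set (torsion_subgroup (homology E k))| = t k.+1.
  exact: (card_torsion (s k.+1 : smith (bd E k))).
have dE k : ln (det' (map_mx (intr : int -> R[i]) (differential E k))) = lt k + (lk k + li k) / 2.
  apply: ln_sqr_split.
  - exact: det'_gt0.
  - exact: t_gt0.
  - by rewrite ltr0z ker_vol_gt0.
  - by rewrite ltr0z im_vol_gt0.
  rewrite (det'_smith R (s k)) intrM intrM rmorphXn /=; congr (_ * _).
  have -> : t k = absz (\prod_i smd (s k) 0 i).
    by rewrite /t (big_morph absz abszM (erefl _)).
  rewrite natr_absz -[LHS]rmorphXn -[RHS]rmorphXn /=; congr (_%:~R).
  by rewrite real_normK ?num_real.
rewrite /homology_torsion lnV; last by rewrite posrE alt_prod_gt0// => k; rewrite tE.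
rewrite ln_alt_prod; last by move=> k; rewrite tE.
rewrite /ray_singer_torsion ln_alt_prod; last by move=> k; exact: det'_gt0.
under eq_bigr do rewrite tE; under [X in _ - X]eq_bigr do rewrite dE.
(* The end terms of both telescoping sums vanish: the differentials leaving degrees 0 and
   [(clength E).+1] have rank 0. *)
have r0 : sm_rank (s 0%N) = 0%N by apply: smith_rank0; rewrite orbT.
have rl : sm_rank (s (clength E).+1) = 0%N.
  by apply: smith_rank0; rewrite (crank_eq0 (ltnSn _)) eqxx.
have [i0 t0] := smith_rank0_im_vol r0; have [il tl] := smith_rank0_im_vol rl.
have st := alt_sum_telescope lt (clength E).
have si := alt_sum_telescope li (clength E).
rewrite /lt /t t0 tl ln1 mulr0 addr0 -/t in st.
rewrite /li i0 il ln1 mulr0 addr0 in si.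
rewrite -sumrN -sumrB; apply/eqP; rewrite -subr_eq0; apply/eqP.
transitivity (- (\sum_(k < (clength E).+1) (-1) ^+ k * (lt k + lt k.+1))
  - (\sum_(k < (clength E).+1) (-1) ^+ k * (li k + li k.+1)) / 2); last first.
  by rewrite st si mul0r subr0 oppr0.
rewrite mulNr opprK !mulr_suml -sumrN -big_split -sumrB; apply: eq_bigr => k _.
rewrite /= -/(lt k.+1) -/(lk k) -/(li k.+1).
by move: (_ ^+ k) (lt k.+1) (lt k) (lk k) (li k) (li k.+1) => e a b c d f; field.
Qed.

(** * Vanishing sums of roots of unity *)

(* If p divides d every exponent 1 + j d is prime to p d; otherwise only one
   residue of j modulo p is bad, which leaves windows of length p - 1. *)
Lemma coprime_window p d k : prime p -> (p %| d)%N || (k < p)%N ->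
  exists j0, forall j, (j < k)%N -> coprime (1 + (j0 + j) * d) (p * d).
Proof.
move=> pp; have co_d j : coprime (1 + j * d) d.
  by rewrite /coprime -gcdn_modl addnC modnMDl gcdn_modl gcd1n.
have [pd|pd] /= := boolP (p %| d)%N.
  move=> _; exists 0%N => j _; rewrite coprimeMr co_d andbT.
  exact: coprime_dvdr pd (co_d _).
move=> kp; have cpd : coprime p d by rewrite prime_coprime.
(* As [x] is -1 modulo [p] and 0 modulo [d], the exponent [1 + x] is the bad one; the window starts
   just after it and ends before the next bad one. *)
pose x := chinese p d (p - 1) 0.
have xp : (p %| 1 + x)%N.
  rewrite /dvdn -modnDmr chinese_modl// modnDmr addnC subnK ?prime_gt0//.
  by rewrite modnn.
have xd : (d %| x)%N by rewrite /dvdn chinese_modr// mod0n.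
exists (x %/ d).+1 => j jk; rewrite coprimeMr co_d andbT coprime_sym prime_coprime//.
have -> : (1 + ((x %/ d).+1 + j) * d = 1 + x + j.+1 * d)%N.
  by rewrite [(_ + j)%N]addSnnS mulnDl divnK// addnA.
rewrite dvdn_addr// Euclid_dvdM// negb_or pd andbT.
by rewrite gtnNdvd// (leq_ltn_trans jk).
Qed.

Lemma dvdn_fact_prime m k : (0 < m)%N ->
  (forall p, prime p -> (p %| m)%N -> (p <= k)%N && ~~ (p %| m %/ p)%N) ->
  (m %| k`!)%N.
Proof.
move=> m0 H; apply/dvdn_partP => // p; rewrite mem_primes => /and3P[pp _ pm].
have /andP[pk ndv] := H p pp pm.
rewrite p_part; have -> : logn p m = 1%N.
  apply/eqP; rewrite eqn_leq -[X in _ && X](pfactor_dvdn 1 pp m0) expn1 pm andbT leqNgt.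
  apply: contra ndv => l2; have := l2; rewrite -(pfactor_dvdn 2 pp m0) => h.
  by rewrite -(dvdn_pmul2r (prime_gt0 pp)) divnK// -expnS.
by rewrite expn1 dvdn_fact// prime_gt0.
Qed.

(* Mann: in a vanishing sum of roots of unity with no vanishing subsum, a
   prime p with p^2 | m or p > #|I| cannot divide the order m of the ratios;
   otherwise suitable Galois conjugates of the sum and a Vandermonde argument
   isolate a proper vanishing subsum. *)
Lemma vanishing_sum_ratio (I : finType) (a : I -> int) (z : I -> algC) (m0 : nat) (i0 : I) :
  (0 < m0)%N -> (forall i, z i ^+ m0 = 1) -> (forall i, a i != 0) ->
  \sum_i (a i)%:~R * z i = 0 ->
  exists i j, i != j /\ (z i / z j) ^+ (#|I|)`! = 1.
Proof.
move=> m0_gt0 zm0 a0 sum0.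
pose P (A : {set I}) := (A != finset.set0) && (\sum_(i in A) (a i)%:~R * z i == 0).
have z0 i : z i != 0.
  by apply: contra_eq_neq (zm0 i) => ->; rewrite expr0n eqn0Ngt m0_gt0 eq_sym oner_eq0.
have PT : P finset.setT.
  apply/andP; split; first by apply/set0Pn; exists i0.
  by apply/eqP; under eq_bigl do rewrite inE.
(* A minimal nonempty vanishing subsum; it has at least two terms because no single term is zero. *)
have [A /minsetP[/andP[A0 /eqP sA] Amin] _] := minset_exists PT.
have /set0Pn[i1 i1A] := A0.
have [i2 i2A i21] : exists2 i2, i2 \in A & i2 != i1.
  apply/exists_inP; apply: contraT; rewrite negb_exists_in => /forall_inP H.
  have eA : A = [set i1].
    apply/setP => i; rewrite inE; apply/idP/eqP => [iA|->//].
    by have := H i iA; rewrite negbK => /eqP.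
  by move/eqP: sA; rewrite eA big_set1 mulf_eq0 intr_eq0 (negPf (a0 _)) (negPf (z0 _)).
exists i2, i1; split=> //.
pose w i := z i / z i1.
have w0 i : w i != 0 by rewrite mulf_neq0 ?invr_eq0.
have sw : \sum_(i in A) (a i)%:~R * w i = 0.
  by under eq_bigr do rewrite mulrA; rewrite -mulr_suml sA mul0r.
have ex : exists m, (0 < m)%N && [forall i in A, w i ^+ m == 1].
  exists m0; rewrite m0_gt0; apply/forall_inP => i _.
  by rewrite expr_div_n !zm0 divr1.
(* [m] is the least common exponent of the ratios [w i] for [i] in [A]. *)
case: (ex_minnP ex) => m /andP[m_gt0 /forall_inP wm] mmin.
have wm1 i : i \in A -> w i ^+ m = 1 by move=> /wm/eqP.
suff dv : (m %| (#|I|)`!)%N by rewrite -(divnK dv) mulnC exprM wm1// expr1n.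
apply: dvdn_fact_prime => // p pp pm; apply: contraT => bad.
pose d := (m %/ p)%N.
have md : m = (p * d)%N by rewrite mulnC divnK.
have d_gt0 : (0 < d)%N by rewrite divn_gt0 ?prime_gt0// dvdn_leq.
have [j0 window] : exists j0, forall j, (j < #|I|)%N -> coprime (1 + (j0 + j) * d) m.
  rewrite md; apply: coprime_window => //; move: bad; rewrite negb_and negbK -ltnNge.
  by rewrite orbC.
pose e i := w i ^+ d.
(* The automorphism raising [m]-th roots of unity to the power [1 + (j0 + j) * d] multiplies [w i]
   by [e i ^+ (j0 + j)]. *)
have conj j : (j < #|I|)%N -> \sum_(i in A) (a i)%:~R * w i * e i ^+ (j0 + j) = 0.
  move=> /window/Qn_aut_exists[u uE]; have := congr1 u sw.
  rewrite rmorph_sum rmorph0 => h; rewrite -[RHS]h; apply: eq_bigr => i iA.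
  by rewrite rmorphM /= rmorph_int uE ?wm1// exprS mulnC exprM mulrA.
have conjp (Q : {poly algC}) : (size Q <= #|I|)%N ->
    \sum_(i in A) (a i)%:~R * w i * e i ^+ j0 * Q.[e i] = 0.
  move=> sQ; under eq_bigr do rewrite (horner_coef_wide _ sQ) mulr_sumr.
  rewrite exchange_big /= big1 // => j _.
  transitivity (Q`_j * \sum_(i in A) (a i)%:~R * w i * e i ^+ (j0 + j)).
    by rewrite mulr_sumr; apply: eq_bigr => i _; rewrite exprD; ring.
  by rewrite conj// mulr0.
pose vals := [seq v <- undup [seq e i | i in A] | v != 1].
(* Instead of inverting a Vandermonde matrix, the conjugates are combined with the coefficients of a
   polynomial vanishing at every value of [e] except 1. Its size is the number of distinct values,
   at most [#|I|]. *)
pose Q : {poly algC} := \prod_(v <- vals) ('X - v%:P).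
have sQ : (size Q <= #|I|)%N.
  rewrite size_prod_XsubC.
  have : (size vals < size (undup [seq e i | i in A]))%N.
    rewrite size_filter -[X in (_ < X)%N](count_predC (fun v => v != 1)) -addn1 leq_add2l.
    rewrite -has_count; apply/hasP; exists 1; last by rewrite /= eqxx.
    rewrite mem_undup; apply/fintype.imageP; exists i1 => //.
    by rewrite /e /w divff// expr1n.
  move=> /leq_trans; apply; apply: leq_trans (size_undup _) _.
  by rewrite size_image max_card.
have Qe i : i \in A -> e i != 1 -> Q.[e i] = 0.
  move=> iA ei; apply/eqP; rewrite -[_ == _]/(root Q (e i)) root_prod_XsubC mem_filter ei mem_undup.
  by apply/fintype.imageP; exists i.
have Q1 : Q.[1] != 0.
  by rewrite -[_ == _]/(root Q 1) root_prod_XsubC mem_filter eqxx.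
pose A' := [set i in A | e i == 1].
have PA' : P A'.
  apply/andP; split.
    by apply/set0Pn; exists i1; rewrite inE i1A /e /w divff// expr1n eqxx.
  have := conjp Q sQ; rewrite (bigID (fun i => e i == 1)) /= [X in _ + X]big1 ?addr0; last first.
    by move=> i /andP[iA ei]; rewrite Qe ?mulr0.
  move=> h; suff h' : (\sum_(i in A') (a i)%:~R * z i) / z i1 * Q.[1] == 0.
    by move: h'; rewrite !mulf_eq0 invr_eq0 (negPf (z0 _)) (negPf Q1) !orbF.
  rewrite -[X in _ == X]h !mulr_suml; apply/eqP; apply: eq_big => i; first by rewrite inE.
  by rewrite inE => /andP[_ /eqP ei]; rewrite ei expr1n mulr1 /w !mulrA.
(* By minimality every [e i] is 1, so [d] is already a common exponent, against the choice of
   [m]. *)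
have AA' : A' = A by apply: Amin => //; apply/fintype.subsetP => i; rewrite inE => /andP[].
have : (m <= d)%N.
  apply: mmin; rewrite d_gt0; apply/forall_inP => i.
  by rewrite -AA' inE => /andP[].
by rewrite leqNgt md ltn_Pmull// prime_gt1.
Qed.

(** * Characters annihilated by an element of the group ring *)

Lemma min_natP (A : set nat) k : A k -> (min_nat A <= k)%N.
Proof.
move=> Ak; have [|_ ] := @xgetPex _ 0%N [set k | A k /\ forall j, A j -> (k <= j)%N].
  have ex : exists j, `[< A j >] by exists k; apply/asboolP.
  case: (ex_minnP ex) => j /asboolP Aj jmin; exists j; split=> // i Ai.
  by apply: jmin; apply/asboolP.
exact.
Qed.

Lemma systole_le n (S : seq 'rV[int]_n) (Gamma : zmodClosed 'rV[int]_n) w x :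
  x \in Gamma -> x != 0 -> is_word S w x -> (systole S Gamma <= size w)%N.
Proof.
move=> xG x0 wx; apply: (@leq_trans (word_length S x)); apply: min_natP.
  by exists x.
by exists w.
Qed.

Lemma is_word_muln n (S : seq 'rV[int]_n) w x k :
  is_word S w x -> is_word S (flatten (nseq k w)) (x *+ k).
Proof.
move=> [wS wx]; elim: k => [|k [IHS IHx]]; first by split=> //; rewrite big_nil.
split=> /= [s|]; first by rewrite mem_cat => /orP[/wS|/IHS].
by rewrite big_cat /= wx IHx mulrS.
Qed.

Lemma size_flatten_nseq (T : Type) (w : seq T) k : size (flatten (nseq k w)) = (k * size w)%N.
Proof. by rewrite size_flatten /shape map_nseq sumn_nseq mulnC. Qed.

Lemma rV_int_muln_eq0 n (x : 'rV[int]_n) k : (0 < k)%N -> (x *+ k == 0) = (x == 0).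
Proof.
move=> k0; apply/eqP/eqP => [/rowP e|->]; last by rewrite mul0rn.
apply/rowP => i; have := e i; rewrite mulmxnE !mxE => /eqP.
by rewrite mulrn_eq0 -leqn0 leqNgt k0 => /eqP.
Qed.

(** By the result on vanishing sums, two elements [u] and [v] of the support satisfy
    [chi (u - v) ^+ M = 1], where [M] is the factorial of the size of the support. So [chi] is
    trivial on [(u - v) *+ M], and these multiples are independent of [chi] and [N]. *)
Lemma torsion_zero_characters n (p : Zpi n) : p != 0 ->
  exists xs : seq 'rV[int]_n, (forall x, x \in xs -> x != 0) /\
  forall (chi : 'rV[int]_n -> algC) N, (0 < N)%N -> {morph chi : x y / x + y >-> x * y} ->
    (forall x, chi x ^+ N = 1) ->
    \sum_(x <- msupp p) (p@_x)%:~R * chi x = 0 -> exists2 x, x \in xs & chi x = 1.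
Proof.
move=> p0; pose I : finType := fset_sub_type (msupp p).
pose M := (#|I|)`!.
pose xs := [seq (val u.1 - val u.2) *+ M | u <- enum {: I * I} & u.1 != u.2].
exists xs; split=> [x|chi N N0 chiM chiN sum0].
  move=> /mapP[[u v]]; rewrite mem_filter /= => /andP[uv _] ->.
  by rewrite rV_int_muln_eq0 ?fact_gt0// subr_eq0.
have [i0 i0P] : exists i0 : 'rV[int]_n, i0 \in msupp p.
  apply/fset0Pn; apply: contraNneq p0 => e; apply/eqP/malgP => k.
  by rewrite mcoeff_outdom ?e// mcoeff0.
have sumI : \sum_(i : I) (p@_(val i))%:~R * chi (val i) = 0.
  by rewrite -[RHS]sum0 big_seq_fsetE.
have a0 (i : I) : p@_(val i) != 0 by rewrite mcoeff_neq0 (valP i).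
have [i [j [ij e]]] := vanishing_sum_ratio [` i0P]%fset N0 (fun i : I => chiN (val i)) a0 sumI.
exists ((val i - val j) *+ M).
  by apply/mapP; exists (i, j); rewrite // mem_filter /= ij mem_enum.
have chi_neq0 x : chi x != 0.
  by apply: contra_eq_neq (chiN x) => ->; rewrite expr0n eqn0Ngt N0 eq_sym oner_eq0.
have chi0 : chi 0 = 1.
  by apply: (mulfI (chi_neq0 0)); rewrite -chiM addr0 mulr1.
have chiX x k : chi (x *+ k) = chi x ^+ k.
  by elim: k => [|k IH]; rewrite ?mulr0n ?chi0 ?expr0// mulrS exprS chiM IH.
rewrite chiX -[RHS]e; congr (_ ^+ _).
by apply: (mulIf (chi_neq0 (val j))); rewrite -chiM subrK divfK.
Qed.

(** * Contractions up to a nonzero scalar *)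

Lemma clear_denominators (R : idomainType) m p (T : 'M[{fraction R}]_(m, p)) :
  exists d (T' : 'M[R]_(m, p)), d != 0 /\
    map_mx (@FracField.tofrac R) T' = FracField.tofrac d *: T.
Proof.
have fracP (x : {fraction R}) : exists u : R * R,
    u.2 != 0 /\ x * FracField.tofrac u.2 = FracField.tofrac u.1.
  elim/quotW: x => r; exists (\n_r, \d_r); split; first exact: denom_ratioP.
  unlock FracField.tofrac; apply/eqP; rewrite piE /= /FracField.equivf.
  by rewrite /FracField.mulf !numden_Ratio ?mulr1 ?mul1r ?denom_ratioP ?oner_neq0// mulrC.
pose num x := (projT1 (cid (fracP x))).1; pose den x := (projT1 (cid (fracP x))).2.
have den0 x : den x != 0 by rewrite /den; case: cid => u [].
have numden x : x * FracField.tofrac (den x) = FracField.tofrac (num x).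
  by rewrite /num /den; case: cid => u [].
pose d := \prod_(u : 'I_m * 'I_p) den (T u.1 u.2).
exists d, (\matrix_(i, j) (num (T i j) * \prod_(u | u != (i, j)) den (T u.1 u.2))); split.
  by apply/prodf_neq0.
apply/matrixP => i j; rewrite !mxE.
have -> : d = den (T i j) * \prod_(u | u != (i, j)) den (T u.1 u.2).
  by rewrite /d (bigD1 (i, j)).
by rewrite !(rmorphM (@FracField.tofrac R)) /= -numden; ring.
Qed.

(** Over the fraction field, [1%:M - D *m pinvmx D] has its rows in the kernel of [D], hence in the
    row space of the next differential. This is a contraction of the identity in degree [k], and [p]
    is a common denominator. *)
Lemma acyclic_contraction n (C : based_complex (Zpi n)) k : L2_acyclic C ->
  exists (p : Zpi n) T U, p != 0 /\ p%:M = differential C k *m T + U *m bd C k.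
Proof.
move=> acy; pose f : {rmorphism Zpi n -> {fraction Zpi n}} := @FracField.tofrac (Zpi n).
pose CF := base_change (@FracField.tofrac (Zpi n)) C.
have dF : differential CF k = map_mx f (differential C k).
  by case: k => [|k'] //=; rewrite map_mx0.
set D := differential CF k; set B := map_mx f (bd C k).
have ker (v : 'rV_(crank CF k)) : v *m D = 0 -> (v <= B)%MS.
  move=> /eqP vD; pose z := Cycle (vD : v \in cycle_pred (C := CF) (k := k)).
  have : is_boundary z.
    rewrite -[z]subr0 [X in is_true X]Quotient.idealrBE; apply/eqP.
    by rewrite [LHS](acy k) [RHS](acy k).
  by move=> /asboolP[c /= ->]; exact: submxMl.
have : (1%:M - D *m pinvmx D <= B)%MS.
  apply/row_subP => i; apply: ker; rewrite -row_mul mulmxBl mul1mx mulmxKpV//.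
  by rewrite subrr row0.
move=> /submxP[U UE].
have one : 1%:M = D *m pinvmx D + U *m B by rewrite -UE addrC subrK.
have [d1 [T1 [d10 T1E]]] := clear_denominators (pinvmx D).
have [d2 [U2 [d20 U2E]]] := clear_denominators U.
exists (d1 * d2), (d2 *: T1), (d1 *: U2); split; first by rewrite mulf_neq0.
have finj : injective (map_mx f : 'M_(crank C k) -> _).
  move=> X Y /matrixP e; apply/matrixP => i j; apply/eqP.
  by have := e i j; rewrite !mxE => /eqP; rewrite tofrac_eq.
apply: finj; rewrite map_scalar_mx map_mxD !map_mxM !map_mxZ T1E U2E -dF -/D -/B.
rewrite -scalemxAr -scalemxAl -!scalemxAr -!scalemxAl !scalerA -!rmorphM /= [d2 * d1]mulrC.
by rewrite -scalerDr -one scalemx1.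
Qed.

(** * Simultaneous diagonalization of commuting permutations *)

Lemma perm_mxX (R : pzSemiRingType) m (s : {perm 'I_m.+1}) k :
  perm_mx (s ^+ k)%g = perm_mx s ^+ k :> 'M[R]_m.+1.
Proof.
elim: k => [|k IH]; first by rewrite expg0 perm_mx1 expr0.
by rewrite expgS perm_mxM IH exprS.
Qed.

Lemma diagonalizable_perm_mx m (s : {perm 'I_m}) :
  exists2 P : 'M[algC]_m, P \in unitmx & similar_diag P (perm_mx s).
Proof.
case: m s => [|m] s.
  by exists 1%:M; rewrite ?unitmx1//; apply/similar_diagPp => -[].
apply/diagonalizableP; have [z zprim] := C_prim_root_exists (order_gt0 s).
(* The minimal polynomial divides ['X^o - 1], with [o] the order of [s], whose roots are
   distinct. *)
exists [seq z ^+ i | i <- index_iota 0 #[s]%g].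
  rewrite /index_iota subn0 map_inj_in_uniq ?iota_uniq// => i j.
  rewrite !mem_iota /= !add0n => il jl.
  by move=> /eqP; rewrite (eq_prim_root_expr zprim) !modn_small// => /eqP.
apply: mxminpoly_min; rewrite big_map (factor_Xn_sub_1 zprim).
rewrite rmorphB /= rmorphXn /= horner_mx_X rmorph1.
by rewrite -perm_mxX expg_order perm_mx1 subrr.
Qed.

Lemma codiagonalizable_perm_mx m (ss : seq {perm 'I_m}) :
  {in ss &, forall s t, (s * t = t * s)%g} ->
  exists2 P : 'M[algC]_m, P \in unitmx &
    forall s, s \in ss -> exists d : 'rV_m, P *m perm_mx s = diag_mx d *m P.
Proof.
move=> css.
have [|P uP /allP h] := (codiagonalizableP [seq perm_mx s : 'M[algC]_m | s <- ss]).1.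
  split; last by move=> _ /mapP[s _ ->]; exact: diagonalizable_perm_mx.
  move=> _ _ /mapP[s sss ->] /mapP[t tss ->].
  by rewrite /comm_mx -!perm_mxM css.
exists P => // s sss.
have /h /similar_diagPex[d] : (perm_mx s : 'M[algC]_m) \in [seq perm_mx s | s <- ss].
  exact: map_f.
by move=> /(similarP uP) dE; exists d.
Qed.

(** * Multiplication operators on the group ring of a finite group *)

Lemma nth_elt_inj (G : zmodType) : injective (@nth_elt G).
Proof.
move=> a b /eqP; rewrite nth_uniq ?fset_uniq//.
by move=> /eqP /val_inj.
Qed.

Lemma nth_elt_surj (G : zmodType) (finG : finite_set [set: G]) (x : G) :
  exists a, nth_elt a = x.
Proof.
have xG : x \in fset_set [set: G] by rewrite in_fset_set// inE.
have lt : (index x (fset_set [set: G]) < group_order G)%N by rewrite index_mem.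
by exists (Ordinal lt); rewrite /nth_elt nth_index.
Qed.

Section Shift.
Variables (G : zmodType) (finG : finite_set [set: G]).

Definition elt_idx (x : G) : 'I_(group_order G) := projT1 (cid (nth_elt_surj finG x)).

Lemma elt_idxK x : nth_elt (elt_idx x) = x.
Proof. exact: projT2 (cid (nth_elt_surj finG x)). Qed.

Lemma shift_inj x : injective (fun a => elt_idx (nth_elt a + x)).
Proof.
move=> a b /(congr1 (@nth_elt G)); rewrite !elt_idxK => /addIr; exact: nth_elt_inj.
Qed.

Definition shift x : {perm 'I_(group_order G)} := perm (@shift_inj x).

Lemma nth_shift x a : nth_elt (shift x a) = nth_elt a + x.
Proof. by rewrite permE elt_idxK. Qed.

Lemma shiftD x y : shift (x + y) = (shift x * shift y)%g.
Proof.
apply/permP => a; apply: nth_elt_inj.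
by rewrite permM !nth_shift addrA.
Qed.

Lemma nth_shiftX x k a : nth_elt ((shift x ^+ k)%g a) = nth_elt a + x *+ k.
Proof.
elim: k => [|k IH]; first by rewrite expg0 perm1 addr0.
by rewrite expgSr permM nth_shift IH mulrSr addrA.
Qed.

Lemma regmxU c x : regmx << c *g x >> = c *: perm_mx (shift x).
Proof.
apply/matrixP => a b; rewrite !mxE mcoeffU mulr_natr; congr (_ *+ nat_of_bool _).
rewrite eq_sym subr_eq -(inj_eq (@nth_elt_inj G)) nth_shift eq_sym addrC.
by [].
Qed.

Lemma regmx_sum (I : Type) (r : seq I) (P : pred I) (F : I -> group_ring G) :
  regmx (\sum_(i <- r | P i) F i) = \sum_(i <- r | P i) regmx (F i).
Proof. exact: (big_morph _ (@regmxD G) (@regmx0 G)). Qed.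

Lemma regmxE p : regmx p = \sum_(x <- msupp p) p@_x *: perm_mx (shift x).
Proof. by rewrite {1}[p]monalgE regmx_sum; apply: eq_bigr => x _; rewrite regmxU. Qed.

Lemma regmx_gr_map (H : zmodType) (f : {additive H -> G}) (p : group_ring H) :
  regmx (gr_map f p) = \sum_(x <- msupp p) p@_x *: perm_mx (shift (f x)).
Proof. by rewrite /gr_map regmx_sum; apply: eq_bigr => x _; rewrite regmxU. Qed.

(** The characters are read off as the joint eigenvalues of the translations. A common exponent is
    the order of the full symmetric group on the base. *)
Lemma shift_characters : exists (P : 'M[algC]_(group_order G))
    (chi : 'I_(group_order G) -> G -> algC),
  [/\ P \in unitmx, forall x, P *m perm_mx (shift x) = diag_mx (\row_a chi a x) *m P,
      forall a, {morph chi a : x y / x + y >-> x * y} &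
      exists2 M, (0 < M)%N & forall a x, chi a x ^+ M = 1].
Proof.
have [|P uP h] := @codiagonalizable_perm_mx _ [seq shift x | x <- fset_set [set: G]].
  by move=> _ _ /mapP[x _ ->] /mapP[y _ ->]; rewrite -!shiftD addrC.
have hx x : exists d : 'rV_(group_order G), P *m perm_mx (shift x) = diag_mx d *m P.
  by apply: h; apply: map_f; rewrite in_fset_set// inE.
pose d x := projT1 (cid (hx x)).
have dE x : P *m perm_mx (shift x) = diag_mx (d x) *m P := projT2 (cid (hx x)).
have PI (e e' : 'rV_(group_order G)) : diag_mx e *m P = diag_mx e' *m P -> e = e'.
  move=> /(congr1 (mulmx^~ (invmx P))); rewrite !mulmxK// => /matrixP eq.
  by apply/rowP => a; have := eq a a; rewrite !mxE eqxx !mulr1n.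
have chiM a : {morph (fun x => d x 0 a) : x y / x + y >-> x * y}.
  move=> x y; suff -> : d (x + y) = \row_a (d x 0 a * d y 0 a) by rewrite mxE.
  apply: PI; rewrite -dE shiftD perm_mxM mulmxA dE -mulmxA dE mulmxA mulmx_diag.
  by [].
have chi0 a : d 0 0 a = 1.
  have -> : d 0 = const_mx 1; last by rewrite mxE.
  apply: PI; rewrite -dE diag_const_mx mul1mx.
  have -> : shift 0 = 1%g; last by rewrite perm_mx1 mulmx1.
  by apply/permP => b; apply: nth_elt_inj; rewrite nth_shift perm1 addr0.
exists P, (fun a x => d x 0 a); split=> //.
  move=> x; rewrite dE; congr (diag_mx _ *m _).
  by apply/rowP => a; rewrite mxE.
exists #|{: {perm 'I_(group_order G)}}|; first by apply/card_gt0P; exists 1%g.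
move=> a x; set M := #|_|.
have xM : x *+ M = 0.
  have e : (shift x ^+ M = 1)%g.
    by apply/eqP; rewrite -order_dvdn /M -cardsT order_dvdG ?inE.
  have := nth_shiftX x M a; rewrite e perm1 => /eqP.
  by rewrite -subr_eq0 opprD addNKr oppr_eq0 => /eqP.
have chiX k : d (x *+ k) 0 a = d x 0 a ^+ k.
  by elim: k => [|k IH]; rewrite ?mulr0n ?chi0 ?expr0// mulrS exprS chiM IH.
by rewrite -chiX xM chi0.
Qed.

End Shift.

(* S inverts p on the characters outside its zero set; the E a are the
   projections onto the characters in the zero set. *)
Lemma regmx_split (H G : zmodType) (finG : finite_set [set: G]) (f : {additive H -> G})
    (p : group_ring H) (xs : seq H) :
  (forall (chi : H -> algC) N, (0 < N)%N -> {morph chi : x y / x + y >-> x * y} ->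
    (forall x, chi x ^+ N = 1) ->
    \sum_(x <- msupp p) (p@_x)%:~R * chi x = 0 -> exists2 x, x \in xs & chi x = 1) ->
  exists (S : 'M[algC]_(group_order G)) (E : 'I_(group_order G) -> 'M[algC]_(group_order G)),
  [/\ 1%:M = S *m map_mx intr (regmx (gr_map f p)) + \sum_a E a,
      forall q, comm_mx S (map_mx intr (regmx q)),
      forall a q, comm_mx (E a) (map_mx intr (regmx q)) &
      forall a, E a = 0 \/ exists2 x, x \in xs & E a *m perm_mx (shift finG (f x)) = E a].
Proof.
move=> hxs; have [P [chi [uP Pchi chiM [M M0 chi1]]]] := shift_characters finG.
pose N := group_order G.
pose ev a : algC := \sum_(x <- msupp p) (p@_x)%:~R * chi a (f x).
(* The commutative algebra of operators that are diagonal in the basis of characters; it contains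
   every translation. *)
pose cj (d : 'rV[algC]_N) := invmx P *m diag_mx d *m P.
have cjM d e : cj d *m cj e = cj (\row_a (d 0 a * e 0 a)).
  by rewrite /cj !mulmxA mulmxK// -[_ *m diag_mx d *m _]mulmxA mulmx_diag.
have cj_perm x : perm_mx (shift finG x) = cj (\row_a chi a x).
  by rewrite /cj -mulmxA -Pchi mulKmx.
have cjC d e : cj d *m cj e = cj e *m cj d.
  by rewrite !cjM; congr cj; apply/rowP => a; rewrite !mxE mulrC.
have cj_comm d q : comm_mx (cj d) (map_mx intr (regmx q)).
  rewrite (regmxE finG) raddf_sum /=; apply: comm_mx_sum => x _.
  rewrite map_mxZ map_perm_mx /comm_mx -scalemxAr -scalemxAl cj_perm.
  by congr (_ *: _).
have cjD d e : cj (d + e) = cj d + cj e.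
  by rewrite /cj raddfD /= mulmxDr mulmxDl.
have cjZ c d : cj (c *: d) = c *: cj d.
  by rewrite /cj linearZ /= -scalemxAr -scalemxAl.
have cj0 : cj 0 = 0 by rewrite /cj raddf0 mulmx0 mul0mx.
have cj1 : cj (const_mx 1) = 1%:M by rewrite /cj diag_const_mx mulmx1 mulVmx.
have cj_sum (I : Type) (r : seq I) (F : I -> 'rV_N) :
    cj (\sum_(i <- r) F i) = \sum_(i <- r) cj (F i).
  exact: (big_morph _ cjD cj0).
have pE : map_mx intr (regmx (gr_map f p)) = cj (\row_a ev a).
  rewrite (regmx_gr_map finG) raddf_sum /=.
  transitivity (cj (\sum_(x <- msupp p) (p@_x)%:~R *: (\row_a chi a (f x)))).
    rewrite cj_sum; apply: eq_bigr => x _.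
    by rewrite cjZ -cj_perm map_mxZ map_perm_mx.
  congr cj; apply/rowP => a; rewrite mxE summxE; apply: eq_bigr => x _.
  by rewrite !mxE.
(* The convention that 0 has inverse 0 makes [S] vanish on the zero set of [p], where the
   projections [E a] take over. *)
pose S := cj (\row_a (ev a)^-1).
pose E a := cj (if ev a == 0 then delta_mx 0 a else 0).
exists S, E; split.
- rewrite pE cjM -cj_sum -cjD -cj1; congr cj; apply/rowP => b.
  rewrite !mxE summxE (bigD1 b)//= big1 ?addr0; last first.
    move=> a ab; case: ifP => _; rewrite !mxE//=.
    by rewrite eq_sym (negPf ab).
  case: ifPn => [/eqP ->|e0]; first by rewrite invr0 mul0r add0r mxE !eqxx.
  by rewrite mulVf// mxE addr0.
- by move=> q; exact: cj_comm.
- by move=> a q; exact: cj_comm.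
move=> a; rewrite /E; case: ifPn => [/eqP ev0|_]; last by left.
right; have [|x xxs cx] := hxs (fun x => chi a (f x)) M M0 _ (fun x => chi1 a (f x)) ev0.
  by move=> x y; rewrite raddfD chiM.
exists x => //; rewrite cj_perm cjM; congr cj; apply/rowP => b; rewrite !mxE eqxx /=.
by case: eqP => [->|_]; rewrite ?mul0r// cx mulr1.
Qed.

(** * Orbits of translations *)

Definition set_row (R : pzRingType) m (O : {set 'I_m}) : 'rV[R]_m := \row_j (j \in O)%:R.

Lemma porbits_mem m (s : {perm 'I_m}) O j : O \in porbits s -> (j \in O) = (O == porbit s j).
Proof.
by move=> /imsetP[i _ ->]; rewrite porbit_sym -eq_porbit_mem.
Qed.

Lemma card_porbits_gt0 m (s : {perm 'I_m}) O : O \in porbits s -> (0 < #|O|)%N.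
Proof. by move=> /imsetP[i _ ->]; apply/card_gt0P; exists i; exact: porbit_id. Qed.

Lemma sum_card_porbits m (s : {perm 'I_m}) : (\sum_(O in porbits s) #|O|)%N = m.
Proof.
rewrite -[RHS]card_ord -sum1_card (partition_big (porbit s) (mem (porbits s))) /=; last first.
  by move=> j _; exact: imset_f.
apply: eq_bigr => O Os; rewrite -sum1_card; apply: eq_bigl => j.
by rewrite (porbits_mem _ Os) eq_sym.
Qed.

(** A fixed vector is constant on each cycle, so it is the combination of the indicators of the
    cycles with these constant values as coefficients. *)
Lemma perm_mx_fixed_span (F : fieldType) m (s : {perm 'I_m}) k (w : 'M[F]_(k, m)) :
  w *m perm_mx s = w -> (w <= \sum_(O <- enum (porbits s)) <<set_row F O>>)%MS.
Proof.
move=> ws; have wc r i j : w r ((s ^+ i)%g j) = w r j.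
  elim: i => [|i IH]; first by rewrite expg0 perm1.
  rewrite expgSr permM -[RHS]IH -{1}ws -[s]invgK -col_permE mxE invgK.
  by rewrite permK.
apply/row_subP => r.
pose val_on (O : {set 'I_m}) : F := if [pick j in O] is Some j then w r j else 0.
have -> : row r w = \sum_(O <- enum (porbits s)) val_on O *: set_row F O.
  apply/rowP => j; rewrite mxE summxE big_enum /=.
  rewrite (bigD1 (porbit s j)) ?imset_f//= big1 ?addr0; last first.
    by move=> O /andP[Os Oj]; rewrite !mxE (porbits_mem _ Os) (negPf Oj) mulr0.
  rewrite !mxE porbit_id mulr1 /val_on; case: pickP => [i|/(_ j)]; last by rewrite porbit_id.
  by move=> /porbitP[e ->]; rewrite wc.
rewrite [X in (X <= _)%MS]big_seq; apply: summx_sub => O Os; apply: scalemx_sub.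
rewrite (big_rem O)//=; apply: submx_trans (addsmxSl _ _); by rewrite genmxE.
Qed.

Lemma sqn_set_row m (O : {set 'I_m}) : sqn (set_row int O) = #|O|%:Z.
Proof.
rewrite sqnE -sum1_card -natz natr_sum big_mkcond [RHS]big_mkcond /=.
by apply: eq_bigr => j _; rewrite mxE; case: (j \in O).
Qed.

(* Schur's test, by expanding the square and 2 |ab| <= a^2 + b^2. *)
Lemma sqn_mulmx_le (F : realFieldType) m p (D : 'M[F]_(m, p)) (K : F) (v : 'rV_m) :
  (forall i, \sum_j `|D i j| <= K) -> (forall j, \sum_i `|D i j| <= K) ->
  sqn (v *m D) <= K ^+ 2 * sqn v.
Proof.
move=> rK cK; rewrite !sqnE.
have [m0|/card_gt0P[i0 _]] := posnP #|'I_m|.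
  rewrite !big1 ?mulr0// => [i _|j _]; first by have := card0_eq m0 i; rewrite inE.
  rewrite mxE big1 ?expr0n// => i _; by have := card0_eq m0 i; rewrite inE.
have K0 : 0 <= K by apply: le_trans (rK i0); rewrite sumr_ge0.
apply: (@le_trans _ _ (\sum_j K * \sum_i v 0 i ^+ 2 * `|D i j|)); last first.
  rewrite -mulr_sumr expr2 -mulrA ler_wpM2l// exchange_big mulr_sumr ler_sum// => i _.
  by rewrite -mulr_sumr mulrC ler_wpM2r ?sqr_ge0.
apply: ler_sum => j _.
apply: (@le_trans _ _ ((\sum_k `|D k j|) * \sum_i v 0 i ^+ 2 * `|D i j|)); last first.
  by rewrite ler_wpM2r// sumr_ge0// => i _; rewrite mulr_ge0 ?sqr_ge0.
rewrite mxE expr2.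
pose a i := `|v 0 i|; pose d i := `|D i j|.
have split_ab : (\sum_i a i * d i) * (\sum_k a k * d k) <=
    \sum_i \sum_k (a i ^+ 2 + a k ^+ 2) / 2 * (d i * d k).
  rewrite big_distrlr /=; apply: ler_sum => i _; apply: ler_sum => k _.
  rewrite mulrACA ler_wpM2r ?mulr_ge0 ?normr_ge0//.
  have := sqr_ge0 (a i - a k); rewrite sqrrB -mulr_natr.
  by move: (a i) (a k) => x y; lra.
apply: (@le_trans _ _ ((\sum_i a i * d i) * (\sum_k a k * d k))).
  have h : `|\sum_i v 0 i * D i j| <= \sum_i a i * d i.
    by apply: le_trans (ler_norm_sum _ _ _) _; apply: ler_sum => i _; rewrite normrM.
  rewrite -expr2 -[leLHS]real_normK ?num_real// expr2.
  by apply: ler_pM.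
apply: (le_trans split_ab).
have -> : \sum_i \sum_k (a i ^+ 2 + a k ^+ 2) / 2 * (d i * d k) =
    (\sum_i \sum_k a i ^+ 2 * d i * d k) / 2 + (\sum_i \sum_k a k ^+ 2 * d k * d i) / 2.
  rewrite -mulrDl -big_split /= mulr_suml; apply: eq_bigr => i _.
  rewrite -big_split /= mulr_suml; apply: eq_bigr => k _.
  by field.
rewrite [X in _ + X / 2]exchange_big /= -splitr exchange_big mulr_suml le_eqVlt.
apply/orP; left; apply/eqP; apply: eq_bigr => k _.
rewrite mulr_sumr; apply: eq_bigr => i _.
by rewrite mulrC /a /d real_normK ?num_real.
Qed.

(** * Block matrices over a finite quotient *)

Lemma big_tagnat (V : nmodType) c (p_ : 'I_c -> nat) (F : forall i, 'I_(p_ i) -> V) :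
  \sum_(k < \sum_i p_ i) F (tagnat.sig1 k) (tagnat.sig2 k) = \sum_i \sum_j F i j.
Proof. by rewrite sig_big_dep /= (reindex _ tagnat.sig_bij_on). Qed.

Section BlockPerm.
Variables (c N : nat) (s : {perm 'I_N}).

Definition block_shift (k : 'I_(\sum_(i < c) N)) : 'I_(\sum_(i < c) N) :=
  @tagnat.Rank _ (fun _ => N) (tagnat.sig1 k) (s (tagnat.sig2 k)).

Lemma sig1_block_shift k : tagnat.sig1 (block_shift k) = tagnat.sig1 k.
Proof. exact: tagnat.Rank1K. Qed.

Lemma sig2_block_shift k : tagnat.sig2 (block_shift k) = s (tagnat.sig2 k) :> 'I_N.
Proof. by apply: val_inj; rewrite /block_shift tagnat.Rank2K. Qed.

Lemma tagnat_inj (k l : 'I_(\sum_(i < c) N)) :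
  tagnat.sig1 k = tagnat.sig1 l -> tagnat.sig2 k = tagnat.sig2 l :> 'I_N -> k = l.
Proof.
move=> e1 e2; rewrite -[k]tagnat.sig2K -[l]tagnat.sig2K; apply: val_inj.
by apply/eqP; rewrite tagnat.eq_Rank e1 eqxx /= e2.
Qed.

Lemma block_shift_inj : injective block_shift.
Proof.
move=> k l e; apply: tagnat_inj.
  by rewrite -sig1_block_shift e sig1_block_shift.
by apply: (@perm_inj _ s); rewrite -!sig2_block_shift e.
Qed.

Definition block_perm := perm block_shift_inj.

Lemma sig2_block_permX k o :
  tagnat.sig2 ((block_perm ^+ o)%g k) = (s ^+ o)%g (tagnat.sig2 k) :> 'I_N.
Proof.
elim: o => [|o IH]; first by rewrite !expg0 !perm1.
by rewrite !expgSr !permM permE sig2_block_shift IH.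
Qed.

Lemma mxdiag_perm_mx (R : pzSemiRingType) :
  \mxdiag_(i < c) (perm_mx s : 'M[R]_N) = perm_mx block_perm.
Proof.
apply/matrixP => k l; rewrite !mxE permE.
have -> : (block_shift k == l) = (tagnat.sig1 k == tagnat.sig1 l) &&
    ((s (tagnat.sig2 k)) == tagnat.sig2 l :> 'I_N).
  apply/eqP/andP => [<-|[/eqP e1 /eqP e2]].
    by rewrite sig1_block_shift sig2_block_shift !eqxx.
  by apply: tagnat_inj; rewrite ?sig1_block_shift ?sig2_block_shift.
by case: eqP => _; rewrite ?conform_mx_id !mxE.
Qed.

End BlockPerm.

Lemma map_mxdiag (R S : nmodType) (f : {additive R -> S}) c (N : nat) (B : 'I_c -> 'M[R]_N) :
  map_mx f (\mxdiag_i B i) = \mxdiag_i map_mx f (B i).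
Proof.
apply/matrixP => k l; rewrite !mxE; case: eqP => _; rewrite ?mxE ?raddf0//.
by rewrite !conform_mx_id mxE.
Qed.

Section BlockMap.
Variables (H G : zmodType) (f : {additive H -> G}).
Let N := group_order G.

Definition regblock a b (X : 'M[group_ring H]_(a, b)) : 'M[int]_(\sum_(i < a) N, \sum_(j < b) N) :=
  \mxblock_(i < a, j < b) regmx (gr_map f (X i j)).

Lemma regblockD a b (X Y : 'M_(a, b)) : regblock (X + Y) = regblock X + regblock Y.
Proof.
by rewrite -mxblockD; apply: eq_mxblock => i j; rewrite mxE raddfD /= regmxD.
Qed.

Lemma regblockM a b d (X : 'M_(a, b)) (Y : 'M_(b, d)) :
  regblock (X *m Y) = regblock X *m regblock Y.
Proof.
rewrite mul_mxblock; apply: eq_mxblock => i j; rewrite mxE raddf_sum /=.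
rewrite (big_morph _ (@regmxD G) (@regmx0 G)).
by apply: eq_bigr => k _; rewrite rmorphM /= regmxM.
Qed.

Lemma regblock_scalar a p : regblock (p%:M : 'M_a) = \mxdiag_(i < a) regmx (gr_map f p).
Proof.
apply: eq_mxblock => i j; rewrite mxE; case: eqP => _.
  by rewrite mulr1n conform_mx_id.
by rewrite mulr0n raddf0 regmx0.
Qed.

Definition gr_l1 (p : group_ring H) : int := \sum_(x <- msupp p) `|p@_x|.

Lemma gr_l1_ge0 p : 0 <= gr_l1 p.
Proof. by apply: sumr_ge0 => x _; exact: normr_ge0. Qed.

(** Each element of the support acts by a permutation matrix, which has a single 1 in every row. The
    bound is thus uniform in [G], as needed for norm bounds independent of the quotient. *)
Lemma regmx_row_sum (finG : finite_set [set: G]) p a :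
  \sum_b `|regmx (gr_map f p) a b| <= gr_l1 p.
Proof.
rewrite (regmx_gr_map finG).
apply: (@le_trans _ _ (\sum_b \sum_(x <- msupp p) `|p@_x| * (shift finG (f x) a == b)%:R)).
  apply: ler_sum => b _; rewrite summxE; apply: le_trans (ler_norm_sum _ _ _) _.
  by apply: ler_sum => x _; rewrite !mxE normrM normr_nat.
rewrite exchange_big /=; apply: ler_sum => x _; rewrite -mulr_sumr.
rewrite (bigD1 (shift finG (f x) a))//= eqxx big1 ?addr0 ?mulr1// => b.
by rewrite eq_sym => /negPf ->.
Qed.

Lemma regmx_col_sum (finG : finite_set [set: G]) p b :
  \sum_a `|regmx (gr_map f p) a b| <= gr_l1 p.
Proof.
rewrite (regmx_gr_map finG).
apply: (@le_trans _ _ (\sum_a \sum_(x <- msupp p) `|p@_x| * (shift finG (f x) a == b)%:R)).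
  apply: ler_sum => a _; rewrite summxE; apply: le_trans (ler_norm_sum _ _ _) _.
  by apply: ler_sum => x _; rewrite !mxE normrM normr_nat.
rewrite exchange_big /=; apply: ler_sum => x _; rewrite -mulr_sumr.
rewrite (bigD1 ((shift finG (f x))^-1%g b))//= permKV eqxx big1 ?addr0 ?mulr1// => a ab.
by rewrite (can2_eq (permK _) (permKV _)) (negPf ab).
Qed.

Definition mx_l1 a b (X : 'M[group_ring H]_(a, b)) : int := \sum_i \sum_j gr_l1 (X i j).

Lemma regblock_row_sum (finG : finite_set [set: G]) a b (X : 'M[group_ring H]_(a, b)) k :
  \sum_l `|regblock X k l| <= mx_l1 X.
Proof.
pose F (j : 'I_b) (l : 'I_N) := `|regmx (gr_map f (X (tagnat.sig1 k) j)) (tagnat.sig2 k) l|.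
rewrite (eq_bigr (fun l => F (tagnat.sig1 l) (tagnat.sig2 l))); last by move=> l _; rewrite mxE.
rewrite (@big_tagnat _ b (fun _ => N) F) /mx_l1 (bigD1 (tagnat.sig1 k))//=.
rewrite -[leLHS]addr0 lerD//.
  by apply: ler_sum => j _; exact: regmx_row_sum.
by apply: sumr_ge0 => i _; apply: sumr_ge0 => j _; exact: gr_l1_ge0.
Qed.

Lemma regblock_col_sum (finG : finite_set [set: G]) a b (X : 'M[group_ring H]_(a, b)) l :
  \sum_k `|regblock X k l| <= mx_l1 X.
Proof.
pose F (i : 'I_a) (k : 'I_N) := `|regmx (gr_map f (X i (tagnat.sig1 l))) k (tagnat.sig2 l)|.
rewrite (eq_bigr (fun k => F (tagnat.sig1 k) (tagnat.sig2 k))); last by move=> k _; rewrite mxE.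
rewrite (@big_tagnat _ a (fun _ => N) F) /mx_l1; apply: ler_sum => i _.
rewrite (bigD1 (tagnat.sig1 l))//= -[leLHS]addr0 lerD//; first exact: regmx_col_sum.
by apply: sumr_ge0 => j _; exact: gr_l1_ge0.
Qed.

Lemma regblock_comm (S : 'M[algC]_N) a b (X : 'M[group_ring H]_(a, b)) :
  (forall q, comm_mx S (map_mx intr (regmx q : 'M_N))) ->
  \mxdiag_(i < a) S *m map_mx intr (regblock X) = map_mx intr (regblock X) *m \mxdiag_(i < b) S.
Proof.
move=> cS.
have -> : map_mx intr (regblock X) =
    \mxblock_(i < a, j < b) map_mx intr (regmx (gr_map f (X i j)) : 'M_N) :> 'M[algC]_(_, _).
  by apply/matrixP => k l; rewrite !mxE.
rewrite mul_mxdiag_mxblock mul_mxblock_mxdiag.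
by apply: eq_mxblock => i j; exact: cS.
Qed.

End BlockMap.

(** Applying [1%:M = S *m P + \sum_i E i] to [v] and expanding [P], the term through [D] vanishes,
    the next lies in the row space of [A] and the last ones in that of [K]. *)
Lemma split_span (F : fieldType) m q l k (I : finType) (D : 'M[F]_(m, q)) (A : 'M[F]_(l, m))
    T U (P S : 'M[F]_m) (E : I -> 'M[F]_m) (K : 'M[F]_(k, m)) :
  P = D *m T + U *m A -> 1%:M = S *m P + \sum_i E i ->
  (forall v : 'rV_m, v *m D = 0 -> v *m S *m D = 0) -> (forall i, (E i <= K)%MS) ->
  forall v : 'rV_m, v *m D = 0 -> (v <= A + K)%MS.
Proof.
move=> PE one kS EK v vD.
have -> : v = v *m S *m U *m A + \sum_i v *m E i.
  rewrite -{1}[v]mulmx1 one mulmxDr PE mulmxA mulmxDr !mulmxA kS// mul0mx add0r.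
  by rewrite mulmx_sumr.
rewrite addmx_sub//; first exact: submx_trans (submxMl _ _) (addsmxSl _ _).
apply: submx_trans (addsmxSr _ _); apply: summx_sub => i _.
exact: submx_trans (submxMl _ _) (EK i).
Qed.

(** The characters live over [algC] while the covolume estimates are over [rat]; inclusion of row
    spaces descends along the field extension. *)
Lemma rat_span m q l (D : 'M[int]_(m, q)) (A : 'M[int]_(l, m)) (kap : seq 'rV[int]_m) :
  (forall v : 'rV[algC]_m, v *m map_mx intr D = 0 ->
    (v <= map_mx intr A + \sum_(x <- kap) <<map_mx intr x>>)%MS) ->
  forall v : 'rV[rat]_m, v *m map_mx intr D = 0 ->
    (v <= map_mx intr A + \sum_(x <- kap) <<map_mx intr x>>)%MS.
Proof.
move=> H v vD; have mapE a b (X : 'M[int]_(a, b)) :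
    map_mx (ratr : rat -> algC) (map_mx intr X) = map_mx intr X.
  by apply/matrixP => i j; rewrite !mxE ratr_int.
have vC : map_mx (ratr : rat -> algC) v *m map_mx intr D = 0.
  by rewrite -(mapE _ _ D) -map_mxM vD map_mx0.
rewrite -(map_submx (ratr : {rmorphism rat -> algC})).
apply: submx_trans (H _ vC) _; rewrite addsmx_sub; apply/andP; split.
  by rewrite -mapE map_submx addsmxSl.
rewrite [X in (X <= _)%MS]big_seq.
set B := map_mx _ _; apply: (big_ind (fun Z => (Z <= B)%MS)); rewrite /B.
- exact: sub0mx.
- by move=> Z1 Z2 h1 h2; rewrite addsmx_sub h1.
move=> x xk; rewrite genmxE -mapE map_submx; apply: submx_trans (addsmxSr _ _).
by rewrite (big_rem x)//=; apply: submx_trans (addsmxSl _ _); rewrite genmxE.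
Qed.

Definition orbit_rows (H G : zmodType) (finG : finite_set [set: G]) (f : H -> G) c (xs : seq H) :
    seq 'rV[int]_(\sum_(i < c) group_order G) :=
  flatten [seq [seq set_row int B |
    B <- enum (porbits (block_perm c (shift finG (f x))))] | x <- xs].

Lemma orbit_rows_span (H G : zmodType) (finG : finite_set [set: G]) (f : H -> G) c xs x k
    (w : 'M[algC]_(k, \sum_(i < c) group_order G)) :
  x \in xs -> w *m perm_mx (block_perm c (shift finG (f x))) = w ->
  (w <= \sum_(y <- orbit_rows finG f c xs) <<map_mx intr y>>)%MS.
Proof.
move=> xxs /perm_mx_fixed_span /submx_trans; apply.
rewrite big_flatten big_map (big_rem x)//=; apply: submx_trans (addsmxSl _ _).
rewrite big_map [X in (_ <= X)%MS](eq_bigr (fun B => <<set_row algC B>>%MS)).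
  exact: submx_refl.
move=> B _.
congr (<<_>>)%MS; apply/rowP => j; rewrite !mxE; by case: (j \in B).
Qed.

Lemma mxdiag_mul (R : pzSemiRingType) c N (B B' : 'M[R]_N) :
  \mxdiag_(i < c) B *m \mxdiag_(i < c) B' = \mxdiag_(i < c) (B *m B').
Proof.
rewrite [X in _ *m X]/mxdiag mul_mxdiag_mxblock; apply: eq_mxblock => i j.
by case: eqP => _; rewrite ?mulmx0// !conform_mx_id.
Qed.

Section AcyclicSpan.
Variables (H G : zmodType) (finG : finite_set [set: G]) (f : {additive H -> G}).
Variables (p : group_ring H) (xs : seq H).
Hypothesis hxs : forall (chi : H -> algC) N, (0 < N)%N -> {morph chi : x y / x + y >-> x * y} ->
    (forall x, chi x ^+ N = 1) ->
    \sum_(x <- msupp p) (p@_x)%:~R * chi x = 0 -> exists2 x, x \in xs & chi x = 1.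
Let N := group_order G.
Variables (c q l : nat).
Variables (D : 'M[int]_(\sum_(i < c) N, q)) (A : 'M[int]_(l, \sum_(i < c) N)).
Variables (T : 'M[int]_(q, \sum_(i < c) N)) (U : 'M[int]_(\sum_(i < c) N, l)).
Hypothesis pE : \mxdiag_(i < c) (regmx (gr_map f p) : 'M_N) = D *m T + U *m A.

(** [S] is only required to preserve the kernel of [D]: this also covers degree 0, where [D] is zero
    and is not given as a block matrix. *)
Lemma acyclic_span :
  (forall S : 'M[algC]_N, (forall y, comm_mx S (map_mx intr (regmx y : 'M_N))) ->
    forall v : 'rV_(\sum_(i < c) N), v *m map_mx intr D = 0 ->
      v *m \mxdiag_(i < c) S *m map_mx intr D = 0) ->
  forall v : 'rV[rat]_(\sum_(i < c) N), v *m map_mx intr D = 0 ->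
    (v <= map_mx intr A + \sum_(x <- orbit_rows finG f c xs) <<map_mx intr x>>)%MS.
Proof.
move=> kD; apply: rat_span; have [S [E [one cS cE Efix]]] := regmx_split finG f hxs.
apply: (split_span (P := map_mx intr (\mxdiag_(i < c) (regmx (gr_map f p) : 'M_N)))
   (T := map_mx intr T) (U := map_mx intr U) (S := \mxdiag_(i < c) S)
   (E := fun a => \mxdiag_(i < c) E a)).
- by rewrite pE map_mxD !map_mxM.
- rewrite map_mxdiag mxdiag_mul -mxdiag_sum -mxdiagD.
  by rewrite -one mxdiagZ.
- exact: kD.
move=> a; have [->|[x xxs Ex]] := Efix a; first by rewrite mxdiag0 sub0mx.
by apply: (orbit_rows_span xxs); rewrite -mxdiag_perm_mx mxdiag_mul Ex.
Qed.

Lemma acyclic_span_tr :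
  (forall S : 'M[algC]_N, (forall y, comm_mx S (map_mx intr (regmx y : 'M_N))) ->
    forall w : 'cV_(\sum_(i < c) N), map_mx intr A *m w = 0 ->
      map_mx intr A *m (\mxdiag_(i < c) S *m w) = 0) ->
  forall v : 'rV[rat]_(\sum_(i < c) N), v *m map_mx intr A^T = 0 ->
    (v <= map_mx intr D^T + \sum_(x <- orbit_rows finG f c xs) <<map_mx intr x>>)%MS.
Proof.
move=> kA; apply: rat_span; have [S [E [one cS cE Efix]]] := regmx_split finG f hxs.
apply: (split_span (P := (map_mx intr (\mxdiag_(i < c) (regmx (gr_map f p) : 'M_N)))^T)
   (T := map_mx intr U^T) (U := map_mx intr T^T) (S := (\mxdiag_(i < c) S)^T)
   (E := fun a => (\mxdiag_(i < c) E a)^T)).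
- by rewrite pE map_trmx linearD /= !trmx_mul map_mxD !map_mxM addrC.
- rewrite -trmx_mul map_mxdiag mxdiag_mul -cS -raddf_sum -linearD /=.
  by rewrite -mxdiag_sum -mxdiagD -one mxdiagZ trmx1.
- move=> v vA; apply: trmx_inj; rewrite trmx0 !trmx_mul trmxK map_trmx trmxK; apply: kA => //.
  by apply: trmx_inj; rewrite trmx_mul trmxK map_trmx vA trmx0.
move=> a; have [->|[x xxs Ex]] := Efix a; first by rewrite mxdiag0 trmx0 sub0mx.
apply: (orbit_rows_span xxs); rewrite -mxdiag_perm_mx.
set B := perm_mx _ in Ex *.
(* Transposition turns [E a *m B = E a] into a statement about [B^T] on the wrong side. As [B]
   commutes with [E a] and is orthogonal, the transpose of [E a] is again fixed by [B] on the
   right. *)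
have BE : B *m E a = E a.
  have := cE a (<< 1 *g f x >>); rewrite (regmxU finG) scale1r map_perm_mx -/B.
  by rewrite /comm_mx Ex => <-.
have BtB : B^T *m B = 1%:M by rewrite tr_perm_mx -perm_mxM mulVg perm_mx1.
rewrite tr_mxdiag mxdiag_mul; congr (mxdiag _); apply/funext => i.
by rewrite -{1}BE trmx_mul -mulmxA BtB mulmx1.
Qed.

End AcyclicSpan.

(** * Estimates in terms of the systole *)

Lemma ln_le_linear (R : realType) (c delta : R) : 0 < c -> 0 < delta ->
  exists L : nat, forall t : R, L%:R <= t -> 0 < t -> ln (c * t) <= delta * t.
Proof.
(* With [ln t <= 2 * Num.sqrt t], the first summand of [a] bounds [ln t], and the second [ln c], by
   half of [delta * t]. *)
move=> c0 d0; pose a : R := (4 / delta) ^+ 2 + `|2 * ln c / delta|.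
exists (Num.bound a) => t Lt t0.
have at_ : a < t.
  apply: lt_le_trans Lt; apply: archi_boundP.
  by rewrite addr_ge0 ?sqr_ge0.
have r0 : 0 < Num.sqrt t by rewrite sqrtr_gt0.
have tE : t = Num.sqrt t ^+ 2 by rewrite sqr_sqrtr// ltW.
have lnt : ln t <= 2 * Num.sqrt t.
  rewrite {1}tE lnXn// mulr2n mulrDl mul1r.
  by have := ln_sublinear r0; lra.
have h1 : 4 / delta <= Num.sqrt t.
  rewrite -[leLHS]ger0_norm ?divr_ge0 ?(ltW d0)// -sqrtr_sqr ler_sqrt ?(ltW t0)//.
  by apply: le_trans (ltW at_); rewrite lerDl.
have h2 : 2 * ln c <= t * delta.
  rewrite -ler_pdivrMr//; apply: le_trans (ltW at_); apply: le_trans (ler_norm _) _.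
  by rewrite lerDr sqr_ge0.
rewrite lnM ?posrE//.
have h3 : 4 * Num.sqrt t <= t * delta.
  by rewrite [X in _ <= X * _]tE expr2 mulrAC ler_pM2r// mulrC -ler_pdivrMl// mulrC.
by move: (ln t) (ln c) (Num.sqrt t) lnt h2 h3 => x y z; lra.
Qed.

Lemma ln_prod_bound (R : realType) m (kap : seq 'rV[int]_m) (c : nat) (delta : R) :
  (0 < c)%N -> (forall x, x \in kap ->
    0 < sqn x /\ ln (c%:R * (sqn x)%:~R) <= delta * (sqn x)%:~R) ->
  0 < c%:Z ^+ size kap * \prod_(x <- kap) sqn x /\
  ln ((c%:Z ^+ size kap * \prod_(x <- kap) sqn x)%:~R) <= delta * (\sum_(x <- kap) sqn x)%:~R.
Proof.
move=> c0; elim: kap => [|x kap IH] h.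
  by rewrite !big_nil mulr1 expr0 ln1 mulr0.
have [|p0 le] := IH; first by move=> y yk; apply: h; rewrite inE yk orbT.
have [sx0 lx] := h x (mem_head _ _).
have -> : c%:Z ^+ size (x :: kap) * \prod_(y <- x :: kap) sqn y =
   (c%:Z * sqn x) * (c%:Z ^+ size kap * \prod_(y <- kap) sqn y).
  by rewrite big_cons /= exprS mulrACA.
have cx0 : 0 < c%:Z * sqn x by rewrite mulr_gt0.
split; first by rewrite mulr_gt0.
rewrite intrM lnM ?posrE ?ltr0z// big_cons intrD mulrDr lerD//.
by rewrite intrM.
Qed.

Lemma ln_vol_bound (R : realType) m (kap : seq 'rV[int]_m) (c : nat) (delta : R) (k i : int) :
  (0 < c)%N -> (forall x, x \in kap ->
    0 < sqn x /\ ln (c%:R * (sqn x)%:~R) <= delta * (sqn x)%:~R) ->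
  0 < k -> 0 < i -> k <= c%:Z ^+ size kap * i * \prod_(x <- kap) sqn x ->
  ln (k%:~R : R) - ln (i%:~R) <= delta * (\sum_(x <- kap) sqn x)%:~R.
Proof.
move=> c0 h k0 i0; rewrite mulrAC => le.
have [] := ln_prod_bound c0 h; move: le; set P := (_ * \prod_(x <- kap) _) => le p0 lep.
rewrite lerBlDr; apply: (@le_trans _ _ (ln ((P * i)%:~R : R))).
  by rewrite ler_ln ?ler_int// posrE ltr0z// mulr_gt0.
by rewrite intrM lnM ?posrE ?ltr0z// lerD2r.
Qed.

(** The squared norm of an indicator is the size of its orbit, and for each element of [xs] the
    orbits partition the whole base. *)
Lemma sum_sqn_orbit_rows (H G : zmodType) (finG : finite_set [set: G]) (f : H -> G) c xs :
  \sum_(x <- orbit_rows finG f c xs) sqn x = (size xs * (c * group_order G))%:Z.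
Proof.
rewrite big_flatten big_map; elim: xs => [|x xs IH]; first by rewrite big_nil.
rewrite big_cons IH /= mulSn PoszD; congr (_ + _).
rewrite big_map (eq_bigr (fun B : {set _} => #|B|%:Z)); last by move=> B _; exact: sqn_set_row.
rewrite big_enum /= -[in RHS](card_ord c) -sum_nat_const.
rewrite -[in RHS](sum_card_porbits (block_perm c (shift finG (f x)))).
by rewrite -natz natr_sum; apply: eq_bigr => B _; rewrite natz.
Qed.

(** The power [o = #|B|] of the translation fixes a base element, so [x *+ o] lies in [Gamma]. It is
    nonzero because the ambient group is torsion-free, and [o] copies of [w] spell it. *)
Lemma orbit_size n (S : seq 'rV[int]_n) (Gamma : zmodClosed 'rV[int]_n)
    (fin : finite_index Gamma) c x w B : x != 0 -> is_word S w x ->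
  B \in porbits (block_perm c (shift fin (quot_proj Gamma x))) ->
  (systole S Gamma <= #|B| * size w)%N.
Proof.
move=> x0 wx /imsetP[k _ BE]; set o := #|B|.
have o0 : (0 < o)%N by apply/card_gt0P; exists k; rewrite BE porbit_id.
rewrite -size_flatten_nseq; apply: (@systole_le _ _ _ _ (x *+ o)).
- have := iter_porbit (block_perm c (shift fin (quot_proj Gamma x))) k.
  rewrite -BE -/o -permX => /(congr1 (fun l => nth_elt (tagnat.sig2 l : 'I_(group_order _)))).
  rewrite sig2_block_permX nth_shiftX => /eqP; rewrite -subr_eq0 addrAC subrr add0r.
  rewrite -raddfMn => /eqP h.
  rewrite -[x *+ o]subr0 [X in is_true X]Quotient.idealrBE; apply/eqP.
  exact: (etrans h (esym (raddf0 (quot_proj Gamma)))).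
- by rewrite rV_int_muln_eq0.
exact: is_word_muln.
Qed.

Lemma map_sqn_mulmx_le m p (D : 'M[int]_(m, p)) (K : int) (v : 'rV[rat]_m) :
  (forall i, \sum_j `|D i j| <= K) -> (forall j, \sum_i `|D i j| <= K) ->
  sqn (v *m map_mx intr D) <= (K ^+ 2)%:~R * sqn v.
Proof.
move=> rK cK; rewrite rmorphXn /=; apply: sqn_mulmx_le => i.
  apply: le_trans (_ : (\sum_j `|D i j|)%:~R <= _); last by rewrite ler_int.
  by rewrite rmorph_sum ler_sum// => j _; rewrite mxE /= intr_norm.
apply: le_trans (_ : (\sum_j `|D j i|)%:~R <= _); last by rewrite ler_int.
by rewrite rmorph_sum ler_sum// => j _; rewrite mxE /= intr_norm.
Qed.

Lemma quot_bdE n (Gamma : zmodClosed 'rV[int]_n) (C : based_complex (Zpi n)) k :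
  bd (quot_complex Gamma C) k = regblock (quot_proj Gamma) (bd C k).
Proof. by apply: eq_mxblock => i j; rewrite mxE. Qed.

Lemma quot_differential n (Gamma : zmodClosed 'rV[int]_n) (fin : finite_index Gamma)
    (C : based_complex (Zpi n)) k (p : Zpi n) T U :
  p%:M = differential C k *m T + U *m bd C k ->
  let D := differential (quot_complex Gamma C) k in
  [/\ exists T', \mxdiag_(i < crank C k) regmx (gr_map (quot_proj Gamma) p) =
        D *m T' + regblock (quot_proj Gamma) U *m bd (quot_complex Gamma C) k,
      bd (quot_complex Gamma C) k *m D = 0,
      forall i, \sum_j `|D i j| <= mx_l1 (differential C k),
      forall j, \sum_i `|D i j| <= mx_l1 (differential C k) &
      forall S : 'M[algC]_(subgroup_index Gamma), (forall y, comm_mx S (map_mx intr (regmx y))) ->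
        forall v : 'rV_(crank (quot_complex Gamma C) k), v *m map_mx intr D = 0 ->
          v *m \mxdiag_(i < crank C k) S *m map_mx intr D = 0].
Proof.
case: k T U => [|k] T U pE D.
  have D0 : D = 0 by [].
  have pE0 : p%:M = U *m bd C 0 by rewrite pE mul0mx add0r.
  split; rewrite ?D0.
  - exists 0; rewrite mulmx0 add0r quot_bdE -regblockM.
    by rewrite -pE0 regblock_scalar.
  - exact: mulmx0.
  - by move=> i; rewrite big_ord0; do 2!apply: sumr_ge0 => ? _; exact: gr_l1_ge0.
  - by case.
  - by move=> S _ v _; rewrite map_mx0 mulmx0.
have DE : D = regblock (quot_proj Gamma) (bd C k) := quot_bdE _ _ _.
rewrite DE; split.
- exists (regblock (quot_proj Gamma) T); rewrite quot_bdE -!regblockM -regblockD.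
  by rewrite -regblock_scalar pE.
- by rewrite -DE; exact: bdK.
- exact: regblock_row_sum.
- exact: regblock_col_sum.
move=> S cS v vD; rewrite -mulmxA regblock_comm//.
by rewrite mulmxA vD mul0mx.
Qed.

(** The element [p], the list [xs], the norm bound [c] and the threshold [L] are all fixed before
    [Gamma], which makes the estimate uniform. *)
Lemma degree_estimate (R : realType) n (C : based_complex (Zpi n)) (S : seq 'rV[int]_n)
    k (eps : R) :
  L2_acyclic C -> generates S -> 0 < eps ->
  exists N0, forall Gamma : zmodClosed 'rV[int]_n, finite_index Gamma ->
    (N0 <= systole S Gamma)%N ->
    forall (sD : smith (differential (quot_complex Gamma C) k))
           (sA : smith (bd (quot_complex Gamma C) k)),
      `|ln (ker_vol sD)%:~R - ln (im_vol sA)%:~R| <= eps * (subgroup_index Gamma)%:R.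
Proof.
move=> acy S_gen eps0.
have [p [T [U [p0 pE]]]] := acyclic_contraction k acy.
have [xs [xs0 hxs]] := torsion_zero_characters p0.
pose KD := mx_l1 (differential C k); pose KA := mx_l1 (bd C k).
(* Bounds the squared operator norms of both [D] and [A^T]; the summand 1 makes it positive. *)
pose c : nat := (absz KD ^ 2 + absz KA ^ 2 + 1)%N.
have c_gt0 : (0 < c)%N by rewrite /c addn1.
have KDc : (KD ^+ 2)%:~R <= c%:R :> rat.
  by rewrite -[c%:R]mulrz_nat ler_int /c; lia.
have KAc : (KA ^+ 2)%:~R <= c%:R :> rat.
  by rewrite -[c%:R]mulrz_nat ler_int /c; lia.
pose w x := projT1 (cid (S_gen x)).
have wP x : is_word S (w x) x := projT2 (cid (S_gen x)).
pose ell := (\max_(x <- xs) size (w x))%N.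
(* The squared norms of the orbit rows add up to [size xs * crank C k] times the index; the
   successor keeps the denominator positive. *)
pose delta : R := eps / (size xs * crank C k).+1%:R.
have delta0 : 0 < delta by rewrite divr_gt0.
have c_gt0R : 0 < c%:R :> R by rewrite ltr0n.
have [L HL] := ln_le_linear c_gt0R delta0.
(* An orbit [B] satisfies [systole S Gamma <= #|B| * ell], so this threshold forces [#|B|] to be at
   least [L]. *)
exists (L * ell.+1)%N => Gamma fin sysG sD sA.
have [[T' pE'] AD rD cD kD] := quot_differential fin pE.
set D := differential _ _ in sD pE' AD rD cD kD *; set A := bd _ k in sA pE' AD *.
pose kap := orbit_rows fin (quot_proj Gamma) (crank C k) xs.
have kapP y : y \in kap -> exists2 B : {set 'I_(\sum_(i < crank C k) subgroup_index Gamma)},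
    sqn y = #|B|%:Z & (0 < #|B|)%N && (L <= #|B|)%N.
  move=> /flatten_mapP[x xxs /mapP[B]]; rewrite mem_enum => Bp ->.
  exists B; first exact: sqn_set_row.
  rewrite (card_porbits_gt0 Bp) /= leqNgt; apply/negP => BL.
  have := leq_trans sysG (orbit_size (xs0 _ xxs) (wP x) Bp); rewrite leqNgt => /negP; apply.
  have szw : (size (w x) <= ell)%N by rewrite /ell (big_rem x)//= leq_maxl.
  apply: leq_ltn_trans (leq_mul (ltnW BL) szw) _.
  by rewrite ltn_pmul2l// (leq_ltn_trans _ BL).
have hk y : y \in kap -> 0 < sqn y /\ ln (c%:R * (sqn y)%:~R) <= delta * (sqn y)%:~R.
  move=> /kapP[B -> /andP[B0 LB]]; split=> //.
  by apply: HL; rewrite ?ler_nat ?ltr0n.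
have kap0 y : y \in kap -> y != 0.
  by move=> /hk[+ _]; apply: contraTneq => ->; rewrite /sqn mul0mx mxE ltxx.
have sumE : delta * (\sum_(x <- kap) sqn x)%:~R <= eps * (subgroup_index Gamma)%:R.
  rewrite sum_sqn_orbit_rows /delta mulrAC ler_pdivrMr// -mulrA ler_pM2l//.
  by rewrite -natrM -pmulrn ler_nat mulnA mulnC leq_mul.
have normD (v : 'rV[rat]_(crank (quot_complex Gamma C) k)) :
    sqn (v *m map_mx intr D) <= c%:R * sqn v.
  by apply: le_trans (map_sqn_mulmx_le _ rD cD) _; rewrite ler_wpM2r ?sqn_ge0.
have normA (v : 'rV[rat]_(crank (quot_complex Gamma C) k)) :
    sqn (v *m map_mx intr A^T) <= c%:R * sqn v.
  apply: le_trans (@map_sqn_mulmx_le _ _ _ KA _ _ _) _; last by rewrite ler_wpM2r ?sqn_ge0.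
    by move=> i; under eq_bigr do rewrite mxE /A quot_bdE; exact: regblock_col_sum.
  by move=> i; under eq_bigr do rewrite mxE /A quot_bdE; exact: regblock_row_sum.
have kA (S0 : 'M[algC]_(subgroup_index Gamma)) :
    (forall y, comm_mx S0 (map_mx intr (regmx y))) ->
    forall v : 'cV_(crank (quot_complex Gamma C) k), map_mx intr A *m v = 0 ->
      map_mx intr A *m (\mxdiag_(i < crank C k) S0 *m v) = 0.
  move=> cS v Av; rewrite mulmxA /A quot_bdE -regblock_comm// -mulmxA -quot_bdE.
  by rewrite Av mulmx0.
have b1 : ker_vol sD <= c%:Z ^+ size kap * im_vol sA * \prod_(x <- kap) sqn x.
  apply: ker_vol_bound => //.
  (* Here the kernel of [D] is compared with the image of [A]; [b2] is the same bound for the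
     transposed complex, where [A^T] and [D^T] exchange roles. *)
  exact: (acyclic_span fin hxs pE' kD).
have b2 : im_vol sA <= c%:Z ^+ size kap * ker_vol sD * \prod_(x <- kap) sqn x.
  rewrite -ker_vol_tr -[ker_vol sD]im_vol_tr; apply: ker_vol_bound => //.
    by rewrite -trmx_mul AD trmx0.
  exact: (acyclic_span_tr fin hxs pE' kA).
rewrite ler_norml; apply/andP; split.
  rewrite lerNl opprB; apply: le_trans sumE.
  by apply: ln_vol_bound b2 => //; rewrite ?im_vol_gt0 ?ker_vol_gt0.
apply: le_trans sumE.
by apply: ln_vol_bound b1 => //; rewrite ?im_vol_gt0 ?ker_vol_gt0.
Qed.

Theorem theorem1 (R : realType) (n : nat) (n_gt0 : (0 < n)%N)
    (C : based_complex (Zpi n)) (C_acyclic : L2_acyclic C)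
    (S : seq 'rV[int]_n) (S_gen : generates S) :
  forall eps : R, 0 < eps ->
  exists N : nat, forall Gamma : zmodClosed 'rV[int]_n,
    finite_index Gamma -> (N <= systole S Gamma)%N ->
    `| (ln (homology_torsion R (quot_complex Gamma C))
        - ln (ray_singer_torsion R (quot_complex Gamma C)))
       / (subgroup_index Gamma)%:R | < eps.
Proof.
move=> eps eps0; pose l := (clength C).+1.
(* Each of the [l] degrees contributes at most [e] times the index; the factor one half in
   [ln_torsion_difference] makes the final inequality strict. *)
pose e : R := eps / l%:R.
have e0 : 0 < e by rewrite divr_gt0.
pose N0 k := projT1 (cid (degree_estimate k C_acyclic S_gen e0)).
have N0P k := projT2 (cid (degree_estimate k C_acyclic S_gen e0)).
exists (\max_(k < l) N0 k)%N => Gamma fin sysG.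
set E := quot_complex Gamma C.
have sE k : exists s : smith (differential E k), True.
  by have [s] := smith_exists (differential E k); exists s.
pose s k := projT1 (cid (sE k)).
rewrite (ln_torsion_difference R s).
have idx0 : 0 < (subgroup_index Gamma)%:R :> R.
  have [a _] := nth_elt_surj fin 0.
  by rewrite ltr0n (leq_ltn_trans _ (ltn_ord a)).
rewrite normrM normfV (gtr0_norm idx0) ltr_pdivrMr// normrM normrN.
rewrite [X in _ * X]ger0_norm ?invr_ge0// ltr_pdivrMr//.
apply: (@le_lt_trans _ _ (\sum_(k < l) e * (subgroup_index Gamma)%:R)).
  apply: le_trans (ler_norm_sum _ _ _) _; apply: ler_sum => k _.
  rewrite normrM normrX normrN1 expr1n mul1r.
  apply: (N0P k Gamma fin _ (s k) (s k.+1 : smith (bd E k))).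
  by apply: leq_trans sysG; exact: (leq_bigmax k).
have le : l%:R * e = eps by rewrite /e mulrC divfK ?pnatr_eq0.
have -> : \sum_(k < l) e * (subgroup_index Gamma)%:R = eps * (subgroup_index Gamma)%:R.
  by rewrite sumr_const card_ord -[LHS]mulr_natl mulrA le.
by rewrite -[ltLHS]mulr1 ltr_pM2l ?mulr_gt0// ltr1n.
Qed.
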